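(* Let $x$ be a symmetric real random variable with $\mathbb{E}x^2=1$, let $x_1,\dots,x_n$ be independent copies of $x$, and put $X=(x_i)_{i=1}^n$. Suppose that there are constants $\gamma,\delta>0$ such that $\mathbb{P}(|x|\ge\gamma)\ge\delta$. Let $0<\alpha<1$, let $N\ge c_0n$, and let $X_1,\dots,X_N$ be independent copies of $X$. Then with probability at least $1-2\exp(-c_1N^{1-\alpha}n^\alpha)$, $$\mathrm{absconv}(X_1,\dots,X_N)\supset c_2\Big(B_\infty^n\cap\sqrt{\alpha\log(eN/n)}\,B_2^n\Big).$$ Here $c_0$ depends only on $\alpha,\gamma,\delta$; $c_2>0$ depends only on $\gamma,\delta$; and $c_1>0$ is an absolute constant.
   Context: $\mathrm{absconv}(X_1,\dots,X_N)$ is the convex hull of $\pm X_1,\dots,\pm X_N$. $B_s^n$ is the closed unit ball of $\ell_s^n$. $\log$ is the natural logarithm. A random variable is symmetric if $x$ and $-x$ have the same distribution. *)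

(* Defs.v *)
From HB Require Import structures.
From mathcomp Require Import all_boot all_order all_algebra.
From mathcomp Require Import all_classical all_reals all_analysis.

Set Implicit Arguments.
Unset Strict Implicit.
Unset Printing Implicit Defensive.

Import Order.TTheory GRing.Theory Num.Theory.
Import numFieldNormedType.Exports.

Local Open Scope classical_set_scope.
Local Open Scope ring_scope.

Section probability_notions.
Context (R : realType).

(* The two variables may live on different probability spaces. *)
Definition same_distribution (d1 d2 d' : measure_display)
    (T1 : measurableType d1) (T2 : measurableType d2) (T' : measurableType d')
    (P1 : probability T1 R) (P2 : probability T2 R)
    (X : T1 -> T') (Y : T2 -> T') : Prop :=
  forall A : set T', measurable A -> pushforward P1 X A = pushforward P2 Y A.

Definition symmetric_rv (d : measure_display) (T : measurableType d)
    (P : probability T R) (x : T -> R) : Prop :=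
  same_distribution P P x (fun t => - x t).

(* Since [A i] may be [setT], this contains the product rule for every
   subfamily. *)
Definition independent_rvs (d d' : measure_display) (T : measurableType d)
    (T' : measurableType d') (P : probability T R) (I : finType)
    (X : I -> T -> T') : Prop :=
  forall A : I -> set T', (forall i, measurable (A i)) ->
    P [set t | forall i, A i (X i t)] = (\prod_i P (X i @^-1` A i))%E.

Definition independent_copies (d0 d d' : measure_display)
    (T0 : measurableType d0) (T : measurableType d) (T' : measurableType d')
    (P0 : probability T0 R) (P : probability T R) (I : finType)
    (X : T0 -> T') (Y : I -> T -> T') : Prop :=
  independent_rvs P Y /\ forall i, same_distribution P0 P X (Y i).

End probability_notions.

Section convex_geometry.
Context (R : realType).

Definition convex_hull (V : lmodType R) (A : set V) : set V :=
  smallest (@convex_set R V) A.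

Definition absconv (V : lmodType R) (I : Type) (X : I -> V) : set V :=
  convex_hull (range X `|` [set - X i | i in [set: I]]).

Definition ball_linf (n : nat) : set 'rV[R]_n :=
  [set v | forall i, `|v ord0 i| <= 1].

Definition ball_l2 (n : nat) : set 'rV[R]_n :=
  [set v | Num.sqrt (\sum_i `|v ord0 i| ^+ 2) <= 1].

Definition dilate (V : lmodType R) (r : R) (A : set V) : set V :=
  [set r *: v | v in A].

(* [n.-tuple R] carries the product sigma-algebra, ['rV[R]_n] the linear
   structure. *)
Definition row_of_tuple (n : nat) (t : n.-tuple R) : 'rV[R]_n :=
  \row_j tnth t j.

End convex_geometry.

Arguments ball_linf {R} n.
Arguments ball_l2 {R} n.

(* Main.v *)
Require Import Defs.
From HB Require Import structures.
From mathcomp Require Import all_boot all_order all_algebra.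
From mathcomp Require Import all_classical all_reals all_analysis.
From mathcomp Require Import measurable_realfun ring lra.

Set Implicit Arguments.
Unset Strict Implicit.
Unset Printing Implicit Defensive.

Import Order.TTheory GRing.Theory Num.Theory.
Import numFieldNormedType.Exports.

Local Open Scope classical_set_scope.
Local Open Scope ring_scope.

(** Write [K] for the body [c2 (B_infty `&` sqrt k B_2)], [k = alpha log (e N / n)],
    and [h_K] for its support function.

    One direction: conditionally on the moduli of the coordinates, [<X, th>] is
    a Rademacher sum; tilting the signs towards a point of [K] that maximises
    [<., th>] gives [P (|<X, th>| > h_K th) >= p] with [p] of order
    [exp (- k / 4)] (second-moment change of measure, two Cauchy-Schwarz
    inequalities).

    All directions at once: no net is needed. Add the small deterministic points
    [+- (c2 / 2) e_j], which lie in [K], to [+- X_1, ..., +- X_N]. If [K] is not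
    contained in the absolutely convex hull, some vertex [th] of the polar of the
    enlarged polytope satisfies [h_K th > 1 >= max_i |<X_i, th>|], and [th] is
    determined by the [n] points on the corresponding facet and their signs.
    Given those points the other [X_i], at least [N - n] of them, are independent
    of [th], so each candidate facet occurs with probability at most
    [(1 - p) ^ (N - n)]. There are at most ['C(N + n, n) 2 ^ n] candidates, and
    the union bound is small because [p N] is of order [N (n / N) ^ (alpha / 4)],
    which dominates both [n log (N / n)] and [N ^ (1 - alpha) n ^ alpha]. *)

(** * Rademacher sums *)

Section rademacher.
Context (R : realType).

(** Multiplied by the total weight [W], the defect is a weighted sum of the squares of
    [W * x i - M]. If [W = 0], every weight in [Q] vanishes and both sides are zero. *)
Lemma weighted_cauchy_schwarz (I : finType) (Q : pred I) (w x : I -> R) :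
  (forall i, 0 <= w i) ->
  (\sum_(i | Q i) w i * x i) ^+ 2 <=
  (\sum_(i | Q i) w i) * (\sum_(i | Q i) w i * x i ^+ 2).
Proof.
move=> w0; set W := \sum_(i | Q i) w i; set M := \sum_(i | Q i) w i * x i.
set V := \sum_(i | Q i) w i * x i ^+ 2.
have W0 : 0 <= W by apply: sumr_ge0.
have key : 0 <= W * (W * V - M ^+ 2).
  have -> : W * (W * V - M ^+ 2) = \sum_(i | Q i) w i * (W * x i - M) ^+ 2.
    transitivity (\sum_(i | Q i) (W ^+ 2 * (w i * x i ^+ 2) +
        (- 2 * W * M) * (w i * x i) + M ^+ 2 * w i)); last first.
      by apply: eq_bigr => i _; ring.
    by rewrite !big_split/= -!mulr_sumr -/W -/M -/V; ring.
  by apply: sumr_ge0 => i _; rewrite mulr_ge0 ?sqr_ge0.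
have [W1|] := ltP 0 W.
  by move: key; rewrite pmulr_rge0// subr_ge0.
move=> W1; have {W1}Weq0 : W = 0 by apply/eqP; rewrite eq_le W1 W0.
have wz i : Q i -> w i = 0.
  by move=> Qi; move/eqP: Weq0; rewrite psumr_eq0// => /allP/(_ i);
    rewrite mem_index_enum Qi => /(_ erefl)/eqP.
by rewrite Weq0 mul0r /M big1 ?expr0n// => i /wz ->; rewrite mul0r.
Qed.

Definition rad (b : bool) : R := if b then 1 else - 1.

Lemma rad_sqr b : rad b ^+ 2 = 1.
Proof. by case: b; rewrite /rad ?sqrrN expr1n. Qed.

Variables (n : nat) (m : 'I_n -> R).

(** The probability of the sign pattern [e] under independent signs with means [m j]. *)
Definition tilt (e : {ffun 'I_n -> bool}) : R :=
  \prod_j ((1 + m j * rad (e j)) / 2).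

(** Independence of the tilted signs. The moments below are instances with [h] equal to 1 in all but
    one or two coordinates; the squared density takes [h] to be the factor itself. *)
Lemma sum_tilt_prod (h : 'I_n -> bool -> R) :
  \sum_e tilt e * \prod_j h j (e j) =
  \prod_j ((1 + m j) / 2 * h j true + (1 - m j) / 2 * h j false).
Proof.
transitivity (\prod_j \sum_(b : bool) ((1 + m j * rad b) / 2 * h j b)).
  rewrite bigA_distr_bigA; apply: eq_bigr => e _.
  by rewrite /tilt -big_split.
by apply: eq_bigr => j _; rewrite big_bool /rad/= mulr1 mulrN1.
Qed.

Lemma sum_tilt : \sum_e tilt e = 1.
Proof.
transitivity (\sum_e tilt e * \prod_(j < n) 1).
  by apply: eq_bigr => e _; rewrite big1 ?mulr1.
by rewrite (sum_tilt_prod (fun _ _ => 1)) big1// => j _; field.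
Qed.

Lemma sum_tilt1 i : \sum_e tilt e * rad (e i) = m i.
Proof.
pose h j b := if j == i then rad b else 1.
transitivity (\sum_e tilt e * \prod_j h j (e j)).
  by apply: eq_bigr => e _; rewrite /h -big_mkcond big_pred1_eq.
rewrite sum_tilt_prod (bigD1 i)//= /h eqxx big1 => [|j /negPf->]; last by field.
by rewrite /rad; field.
Qed.

Lemma sum_tilt2 i j : i != j ->
  \sum_e tilt e * (rad (e i) * rad (e j)) = m i * m j.
Proof.
move=> ij.
pose h l b := (if l == i then rad b else 1) * (if l == j then rad b else 1).
transitivity (\sum_e tilt e * \prod_l h l (e l)).
  apply: eq_bigr => e _.
  by rewrite /h big_split/= -!big_mkcond !big_pred1_eq.
rewrite sum_tilt_prod (bigD1 i)//= (bigD1 j)//=; last by rewrite eq_sym.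
rewrite /h !eqxx (negPf ij) eq_sym (negPf ij).
rewrite big1 => [|l /andP[/negPf-> /negPf->]]; last by field.
by rewrite /rad; field.
Qed.

(** Relative to the uniform measure the density is [2 ^+ n * tilt m e]; the product is its squared
    L2 norm. *)
Lemma sum_tilt_sqr : \sum_e tilt e ^+ 2 = 2 ^- n * \prod_j (1 + m j ^+ 2).
Proof.
pose h j b := (1 + m j * rad b) / 2.
transitivity (\sum_e tilt e * \prod_j h j (e j)).
  by apply: eq_bigr => e _; rewrite expr2.
rewrite sum_tilt_prod -[X in 2 ^- X](card_ord n) -exprVn -prodr_const.
rewrite -big_split/=.
by apply: eq_bigr => j _; rewrite /h /rad; field.
Qed.

Hypothesis m1 : forall j, `|m j| <= 1.

Lemma tilt_ge0 e : 0 <= tilt e.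
Proof.
apply: prodr_ge0 => j _; rewrite divr_ge0//.
have := m1 j; rewrite ler_norml => /andP[? ?].
by rewrite /rad; case: (e j); lra.
Qed.

Lemma sum_tilt_lin (a : 'I_n -> R) :
  \sum_e tilt e * (\sum_j a j * rad (e j)) = \sum_j a j * m j.
Proof.
under eq_bigr do rewrite mulr_sumr.
rewrite exchange_big/=; apply: eq_bigr => j _.
by rewrite -(sum_tilt1 j) mulr_sumr; apply: eq_bigr => e _; ring.
Qed.

(** Off the diagonal the terms agree with those of the squared mean. On the diagonal [a i ^+ 2]
    appears, and the squares of [a i * m i] are added for free. *)
Lemma sum_tilt_quad (a : 'I_n -> R) :
  \sum_e tilt e * (\sum_j a j * rad (e j)) ^+ 2 <=
  (\sum_j a j * m j) ^+ 2 + \sum_j a j ^+ 2.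
Proof.
have -> : \sum_e tilt e * (\sum_j a j * rad (e j)) ^+ 2 =
    \sum_i \sum_j a i * a j * (\sum_e tilt e * (rad (e i) * rad (e j))).
  under eq_bigr => e _.
    rewrite expr2 mulr_suml mulr_sumr.
    under eq_bigr do rewrite !mulr_sumr.
    over.
  rewrite exchange_big/=; apply: eq_bigr => i _.
  rewrite exchange_big/=; apply: eq_bigr => j _.
  by rewrite mulr_sumr; apply: eq_bigr => e _; ring.
rewrite expr2 mulr_suml -big_split/=; apply: ler_sum => i _.
rewrite mulr_sumr (bigD1 i)//= [in leRHS](bigD1 i)//=.
under eq_bigr do rewrite -expr2 rad_sqr mulr1.
rewrite sum_tilt mulr1.
under eq_bigr => j ji do rewrite sum_tilt2 1?eq_sym//.
have -> : \sum_(j | j != i) a i * a j * (m i * m j) =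
  \sum_(j | j != i) a i * m i * (a j * m j) by apply: eq_bigr => j _; ring.
rewrite -expr2 [leRHS]addrAC lerD2r lerDr.
by rewrite -expr2 sqr_ge0.
Qed.

End rademacher.

Lemma prod_le_expR (R : realType) (n : nat) (m : 'I_n -> R) :
  \prod_j (1 + m j ^+ 2) <= expR (\sum_j m j ^+ 2).
Proof.
rewrite expR_sum; apply: ler_prod => j _.
by rewrite addr_ge0 ?sqr_ge0//= expR_ge1Dx.
Qed.

(* Second-moment change of measure: the signs are tilted towards [v], which
   costs only [exp (k / 4)] in the L2 norm of the density. *)
Lemma rademacher_tail (R : realType) (n : nat) (a v : 'I_n -> R) (k : R) :
  (forall j, `|v j| <= 1) -> \sum_j v j ^+ 2 <= k ->
  let A := \sum_j `|v j| * `|a j| in let B := \sum_j a j ^+ 2 in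
  0 < A ->
  (A ^+ 2 / (16 * B + 4 * A ^+ 2)) ^+ 2 * expR (- (k / 4)) * 2 ^+ n <=
  #|[pred e : {ffun 'I_n -> bool} | A / 4 < \sum_j a j * rad R (e j)]|%:R.
Proof.
move=> v1 vk A B A0.
(* Half of [v] with the signs of [a]: the tilted mean becomes [A / 2], twice the threshold, while
   the squares of [m] sum to at most [k / 4]. *)
pose m j := `|v j| / 2 * Num.sg (a j).
have m1 j : `|m j| <= 1.
  rewrite /m normrM normrM normr_id normfV (ger0_norm (_ : 0 <= 2))// normr_sg.
  by have := v1 j; case: (a j != 0) => /=; rewrite ?mulr1 ?mulr0//; lra.
have am : \sum_j a j * m j = A / 2.
  rewrite /A mulr_suml; apply: eq_bigr => j _.
  by rewrite /m [`|a j|]normrEsg; ring.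
pose S (e : {ffun 'I_n -> bool}) := \sum_j a j * rad R (e j).
set E := [pred e | _].
pose q := \sum_(e in E) tilt m e.
have t0 e : 0 <= tilt m e by exact: tilt_ge0.
have q0 : 0 <= q by apply: sumr_ge0.
(* Patterns outside [E] contribute at most [A / 4] to the mean [A / 2]. *)
have SE : A / 4 <= \sum_(e in E) tilt m e * S e.
  have := sum_tilt_lin m a; rewrite am (bigID (mem E))/= => h.
  have : \sum_(e | e \notin E) tilt m e * S e <= A / 4.
    apply: (@le_trans _ _ (\sum_(e | e \notin E) tilt m e * (A / 4))).
      apply: ler_sum => e; rewrite inE -leNgt => Se.
      exact: ler_wpM2l.
    rewrite -mulr_suml -[leRHS]mul1r ler_wpM2r ?divr_ge0 ?(ltW A0)//.
    rewrite -(sum_tilt m) [leRHS](bigID (mem E))/= lerDr.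
    exact: sumr_ge0.
  by move: h; rewrite -/(S _) => h ?; lra.
(* First Cauchy-Schwarz, with the tilted weights: the mean over [E] against the tilted second
   moment. *)
have CS1 : (A / 4) ^+ 2 <= q * (B + (A / 2) ^+ 2).
  apply: (@le_trans _ _ ((\sum_(e in E) tilt m e * S e) ^+ 2)).
    by rewrite lerXn2r// ?nnegrE ?divr_ge0 ?(ltW A0)// (le_trans _ SE)// divr_ge0 ?(ltW A0).
  apply: (le_trans (weighted_cauchy_schwarz _ _ t0)).
  apply: ler_wpM2l => //.
  apply: (@le_trans _ _ (\sum_e tilt m e * S e ^+ 2)).
    rewrite [leRHS](bigID (mem E))/= lerDl.
    by apply: sumr_ge0 => e _; rewrite mulr_ge0 ?sqr_ge0.
  by rewrite addrC -am; exact: sum_tilt_quad.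
(* Second Cauchy-Schwarz, with unit weights: it passes from the tilted mass [q] of [E] to its
   cardinality. *)
have CS2 : q ^+ 2 <= #|E|%:R * (2 ^- n * expR (k / 4)).
  have := @weighted_cauchy_schwarz R _ (mem E) (fun=> 1) (tilt m) (fun=> ler01).
  under eq_bigr do rewrite mul1r.
  under [X in _ <= X * _]eq_bigr do rewrite -[1]/(1%:R).
  rewrite sumr_const -/q => /le_trans; apply.
  rewrite -mulr_natl mulr1; apply: ler_wpM2l => //.
  under eq_bigr do rewrite mul1r.
  apply: (@le_trans _ _ (\sum_e tilt m e ^+ 2)).
    rewrite [leRHS](bigID (mem E))/= lerDl.
    by apply: sumr_ge0 => e _; rewrite sqr_ge0.
  rewrite sum_tilt_sqr ler_wpM2l ?invr_ge0 ?exprn_ge0//.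
  apply: (le_trans (prod_le_expR _)); rewrite ler_expR.
  apply: (@le_trans _ _ (\sum_j v j ^+ 2 / 4)); last by rewrite -mulr_suml ler_wpM2r.
  apply: ler_sum => j _; rewrite /m exprMn sqr_sg.
  have -> : (`|v j| / 2) ^+ 2 = v j ^+ 2 / 4.
    by rewrite exprMn real_normK ?num_real//; congr (_ * _); field.
  by rewrite ler_piMr ?divr_ge0 ?sqr_ge0//; case: (_ != _).
have B0 : 0 <= B by apply: sumr_ge0 => j _; exact: sqr_ge0.
have A20 : 0 < A ^+ 2 by rewrite exprn_gt0.
set r := A ^+ 2 / _.
have rq : r <= q.
  rewrite ler_pdivrMr; last by lra.
  by move: CS1; rewrite !exprMn !exprVn => h; lra.
have r0 : 0 <= r by rewrite divr_ge0//; lra.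
have rq2 : r ^+ 2 <= q ^+ 2 by rewrite lerXn2r.
move: (le_trans rq2 CS2).
have p0 : 0 < expR (k / 4) by rewrite expR_gt0.
have n0 : 0 < 2 ^+ n :> R by rewrite exprn_gt0.
move=> h; rewrite expRN.
have -> : r ^+ 2 / expR (k / 4) * 2 ^+ n = r ^+ 2 / (2 ^- n * expR (k / 4)).
  by field; rewrite !gt_eqF.
by rewrite ler_pdivrMr// mulr_gt0// invr_gt0.
Qed.

(** * Product measures and independence *)

Lemma measurable_forall (d : measure_display) (T : measurableType d)
    (I : finType) (F : I -> set T) :
  (forall i, measurable (F i)) -> measurable [set x | forall i, F i x].
Proof.
move=> mF; have -> : [set x | forall i, F i x] = \bigcap_(i in setT) F i.
  by apply/seteqP; split => x /= h i; [move=> _; exact: h|exact: h].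
exact: fin_bigcap_measurable.
Qed.

(** Boxes are stable under intersection and generate the product sigma-algebra, so the uniqueness
    theorem for finite measures applies. *)
Lemma tuple_measure_unique (R : realType) (d : measure_display)
    (S : measurableType d) (m : nat)
    (mu nu : {measure set (m.-tuple S) -> \bar R}) :
  (mu setT < +oo)%E ->
  (forall A : 'I_m -> set S, (forall i, measurable (A i)) ->
    mu [set x | forall i, A i (tnth x i)] = nu [set x | forall i, A i (tnth x i)]) ->
  forall E, measurable E -> mu E = nu E.
Proof.
move=> mufin munu E mE.
pose G : set (set (m.-tuple S)) :=
  [set B | exists2 A : 'I_m -> set S, (forall i, measurable (A i)) &
           B = [set x | forall i, A i (tnth x i)]].
have mbox (A : 'I_m -> set S) : (forall i, measurable (A i)) ->
    measurable [set x : m.-tuple S | forall i, A i (tnth x i)].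
  move=> mA; apply: (measurable_forall (F := fun i => (@tnth _ S)^~ i @^-1` A i)).
  move=> i; rewrite -[X in measurable X]setTI.
  exact: measurable_tnth.
apply: (g_sigma_algebra_measure_unique G _ (fun=> setT)) => //.
- by move=> B [A mA ->]; exact: mbox.
- by move=> _; exists (fun=> setT) => //; apply/seteqP; split.
- by rewrite bigcup_const//; exists 0%N.
- move=> _ _ [A mA ->] [B mB ->]; exists (fun i => A i `&` B i).
    by move=> i; exact: measurableI.
  apply/seteqP; split => x /=; first by move=> [a b] i; split.
  by move=> h; split => i; have [] := h i.
- by move=> _ [A mA ->]; exact: munu.
- move: E mE; apply: smallest_sub; first exact: smallest_sigma_algebra.
  move=> B; rewrite -bigcup_seq => -[i _ [C mC <-]].
  apply: sub_sigma_algebra; exists (fun j => if j == i then C else setT).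
    by move=> j; case: ifP.
  apply/seteqP; split => x /=.
    by move=> [_ Cx] j; case: eqP => // ->.
  by move=> /(_ i); rewrite eqxx; split.
Qed.

(** * Independence of two complementary blocks of variables *)

Section independent_blocks.
Context (R : realType) (d d1 d2 : measure_display) (T : measurableType d)
  (S : measurableType d1) (S' : measurableType d2) (P : probability T R).
Variables (N : nat) (X : 'I_N -> T -> S) (f g : 'I_N -> S -> S').
Hypothesis mX : forall i, measurable_fun setT (X i).
Hypothesis mf : forall i, measurable_fun setT (f i).
Hypothesis mg : forall i, measurable_fun setT (g i).
Hypothesis indX : independent_rvs P X.
(** Encodes a splitting of the indices: each variable is visible to at most one of the two blocks,
    the other seeing a constant, so both blocks remain full [N]-tuples. *)
Hypothesis cst_fg :
  forall i, (exists s, forall x, f i x = s) \/ (exists s, forall x, g i x = s).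

Let Y (t : T) : N.-tuple S' := [tuple f i (X i t) | i < N].
Let Z (t : T) : N.-tuple S' := [tuple g i (X i t) | i < N].

Let mY : measurable_fun setT Y.
Proof.
apply/measurable_fun_tnthP => i.
rewrite (_ : _ \o _ = f i \o X i); last by apply/funext => t /=; rewrite tnth_mktuple.
exact: measurableT_comp.
Qed.

Let mZ : measurable_fun setT Z.
Proof.
apply/measurable_fun_tnthP => i.
rewrite (_ : _ \o _ = g i \o X i); last by apply/funext => t /=; rewrite tnth_mktuple.
exact: measurableT_comp.
Qed.

HB.instance Definition _ := isMeasurableFun.Build _ _ _ _ Y mY.
HB.instance Definition _ := isMeasurableFun.Build _ _ _ _ Z mZ.

Let box (A : 'I_N -> set S') := [set x : N.-tuple S' | forall i, A i (tnth x i)].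

Let mbox A : (forall i, measurable (A i)) -> measurable (box A).
Proof.
move=> mA; apply: (measurable_forall (F := fun i => (@tnth _ S')^~ i @^-1` A i)).
by move=> i; rewrite -[X in measurable X]setTI; exact: measurable_tnth.
Qed.

Let mpre (h : S -> S') A : measurable_fun setT h -> measurable A ->
  measurable (h @^-1` A).
Proof. by move=> mh mA; rewrite -[X in measurable X]setTI; exact: mh. Qed.

Let indep_box A B : (forall i, measurable (A i)) -> (forall i, measurable (B i)) ->
  (P (Y @^-1` box A `&` Z @^-1` box B) = P (Y @^-1` box A) * P (Z @^-1` box B))%E.
Proof.
move=> mA mB.
have YE : Y @^-1` box A = [set t | forall i, (f i @^-1` A i) (X i t)].
  by apply/seteqP; split => t /= h i; have := h i; rewrite tnth_mktuple.
have ZE : Z @^-1` box B = [set t | forall i, (g i @^-1` B i) (X i t)].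
  by apply/seteqP; split => t /= h i; have := h i; rewrite tnth_mktuple.
have YZE : Y @^-1` box A `&` Z @^-1` box B =
    [set t | forall i, (f i @^-1` A i `&` g i @^-1` B i) (X i t)].
  rewrite YE ZE; apply/seteqP; split => t /=; first by move=> [a b] i; split.
  by move=> h; split => i; have [] := h i.
have PY := indX (fun i => mpre (mf i) (mA i)).
have PZ := indX (fun i => mpre (mg i) (mB i)).
have PYZ := indX (fun i => measurableI _ _ (mpre (mf i) (mA i)) (mpre (mg i) (mB i))).
rewrite YZE YE ZE PY PZ PYZ.
rewrite -big_split/=; apply: eq_bigr => i _.
(* The preimage under the constant map is everything or empty, so the product rule holds in each
   coordinate. *)
have [[s fs]|[s gs]] := cst_fg i.
  have [As|As] := pselect (A i s).
    rewrite (_ : f i @^-1` A i = setT); last by apply/seteqP; split=> x //=; rewrite fs.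
    by rewrite setTI preimage_setT probability_setT mul1e.
  rewrite (_ : f i @^-1` A i = set0); last by apply/seteqP; split=> x //=; rewrite fs.
  by rewrite set0I preimage_set0 measure0 mul0e.
have [Bs|Bs] := pselect (B i s).
  rewrite (_ : g i @^-1` B i = setT); last by apply/seteqP; split=> x //=; rewrite gs.
  by rewrite setIT preimage_setT probability_setT mule1.
rewrite (_ : g i @^-1` B i = set0); last by apply/seteqP; split=> x //=; rewrite gs.
by rewrite setI0 preimage_set0 measure0 mule0.
Qed.

Let fin (A : set T) : measurable A -> P A \is a fin_num.
Proof. by move=> mA; exact: fin_num_measure. Qed.

(** With [V] fixed, both sides are finite measures in [U], so boxes decide. Used once for each
    block. *)
Let ext (W W' : {mfun T >-> N.-tuple S'}) (V : set (N.-tuple S')) : measurable V ->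
  (forall A, (forall i, measurable (A i)) ->
    P (W @^-1` box A `&` W' @^-1` V) = (P (W @^-1` box A) * P (W' @^-1` V))%E) ->
  forall U, measurable U ->
    P (W @^-1` U `&` W' @^-1` V) = (P (W @^-1` U) * P (W' @^-1` V))%E.
Proof.
move=> mV h U mU.
have mD : measurable (W' @^-1` V) by exact: measurable_funPTI.
have q0 : (0 <= fine (P (W' @^-1` V)))%R by rewrite fine_ge0.
have -> : P (W @^-1` U `&` W' @^-1` V) = pushforward (mrestr P mD) W U by [].
have -> : (P (W @^-1` U) * P (W' @^-1` V) =
    mscale (NngNum q0) (pushforward P W) U)%E.
  by rewrite /mscale/= /pushforward fineK ?fin// muleC.
apply: tuple_measure_unique => //.
  rewrite /= /pushforward /mrestr preimage_setT setTI.
  by rewrite (le_lt_trans (probability_le1 _ mD))// ltry.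
move=> A mA; rewrite /= /mscale/= /pushforward /mrestr fineK ?fin//.
by rewrite muleC; exact: h.
Qed.

Lemma independent_blocks U V : measurable U -> measurable V ->
  P (Y @^-1` U `&` Z @^-1` V) = (P (Y @^-1` U) * P (Z @^-1` V))%E.
Proof.
move=> mU mV; rewrite setIC muleC.
apply: (@ext (Z : {mfun T >-> _}) (Y : {mfun T >-> _})) => // B mB.
rewrite setIC muleC.
apply: (@ext (Y : {mfun T >-> _}) (Z : {mfun T >-> _})) => //; first exact: mbox.
by move=> A mA; exact: indep_box.
Qed.

(* Conditioning on the first block: the second condition is on the law of [Z]
   at the frozen value [Y t]. *)
Lemma independent_blocks_section (E : set (N.-tuple S' * N.-tuple S')) (q : R) :
  measurable E -> 0 <= q ->
  measurable [set t | E (Y t, Z t) /\ (P [set s | E (Y t, Z s)] <= q%:E)%E] /\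
  (P [set t | E (Y t, Z t) /\ (P [set s | E (Y t, Z s)] <= q%:E)%E] <= q%:E)%E.
Proof.
move=> mE q0.
pose G := [set y | (distribution P Z (xsection E y) <= q%:E)%E].
have mG : measurable G.
  rewrite -[G]setTI; apply: measurable_lee => //.
  exact: measurable_fun_xsection.
pose E' := E `&` (G `*` setT).
have mE' : measurable E' by apply: measurableI => //; exact: measurableX.
pose YZ t := (Y t, Z t).
have mYZ : measurable_fun setT YZ by exact: measurable_fun_pair.
have eqE : [set t | E (Y t, Z t) /\ (P [set s | E (Y t, Z s)] <= q%:E)%E] = YZ @^-1` E'.
  apply/seteqP; split => t /=; rewrite /E' /G /distribution /pushforward/=.
    move=> [Et h]; split => //; split => //=.
    by rewrite (_ : _ @^-1` _ = [set s | E (Y t, Z s)])//;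
      apply/seteqP; split => s /=; rewrite /xsection/= inE.
  move=> [Et [/= h _]]; split => //.
  by rewrite (_ : [set s | E (Y t, Z s)] = Z @^-1` xsection E (Y t))//;
      apply/seteqP; split => s /=; rewrite /xsection/= inE.
rewrite eqE; split; first by rewrite -[X in measurable X]setTI; exact: mYZ.
pose YZm : {mfun T >-> (N.-tuple S' * N.-tuple S')%type} :=
  HB.pack YZ (isMeasurableFun.Build _ _ _ _ YZ mYZ).
(* The joint law is the product of the two laws, so the probability is the integral of the section
   masses. *)
have <- : (distribution P Y \x distribution P Z)%E E' = P (YZ @^-1` E').
  apply: (@product_measure_unique _ _ _ _ R (distribution P Y) (distribution P Z)
    (distribution P YZm)) => // U V mU mV.
  by rewrite -independent_blocks.
rewrite /product_measure1/=.
apply: (@le_trans _ _ (\int[distribution P Y]_x (cst q%:E x))%E); last first.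
  by rewrite integral_cst//= probability_setT mule1.
apply: ge0_le_integral => //.
- exact: measurable_fun_xsection.
- move=> y _ /=; have [Gy|Gy] := pselect (G y).
    apply: (le_trans _ Gy); apply: le_measure; rewrite ?inE; [exact: measurable_xsection..|].
    by move=> z; rewrite /xsection/= !inE => -[].
  rewrite (_ : xsection E' y = set0) ?measure0 ?lee_fin//.
  by apply/seteqP; split => z //; rewrite /xsection/= inE => -[_ []].
Qed.

End independent_blocks.

(** * Absolutely convex hulls *)

(** Replaces the bundled interval weight of [convex_set] by a real number with two inequalities. *)
Lemma convex_setP (R : realType) (V : lmodType R) (C : set V) :
  @convex_set R V C <->
  forall x y (l : R), C x -> C y -> 0 <= l -> l <= 1 -> C (l *: x + (1 - l) *: y).
Proof.
split=> [cC x y l Cx Cy l0 l1|h x y l].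
  have l01 : Itv.spec (@Itv.num_sem R) (Itv.Real `[0%Z, 1%Z]) l.
    by apply/and3P; split; rewrite ?num_real//= in_itv/= ?l0 ?l1.
  have := cC x y (Itv.mk l01); rewrite !inE => /(_ Cx Cy).
  by [].
rewrite !inE => Cx Cy; apply: h => //.
Qed.

Section dot_product.
Context (R : realType) (n : nat).
Implicit Types u v w : 'rV[R]_n.

Definition dot u v : R := \sum_j u ord0 j * v ord0 j.

Lemma dotC u v : dot u v = dot v u.
Proof. by apply: eq_bigr => j _; rewrite mulrC. Qed.

Lemma dotDl u v w : dot (u + v) w = dot u w + dot v w.
Proof. by rewrite -big_split; apply: eq_bigr => j _; rewrite !mxE mulrDl. Qed.

Lemma dotZl (a : R) u v : dot (a *: u) v = a * dot u v.
Proof. by rewrite mulr_sumr; apply: eq_bigr => j _; rewrite !mxE mulrA. Qed.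

Lemma dotNl u v : dot (- u) v = - dot u v.
Proof. by rewrite -scaleN1r dotZl mulN1r. Qed.

Lemma dotBl u v w : dot (u - v) w = dot u w - dot v w.
Proof. by rewrite dotDl dotNl. Qed.

Lemma dotDr u v w : dot u (v + w) = dot u v + dot u w.
Proof. by rewrite dotC dotDl !(dotC u). Qed.

Lemma dotZr (a : R) u v : dot u (a *: v) = a * dot u v.
Proof. by rewrite dotC dotZl dotC. Qed.

Lemma dotNr u v : dot u (- v) = - dot u v.
Proof. by rewrite dotC dotNl dotC. Qed.

Lemma dotBr u v w : dot u (v - w) = dot u v - dot u w.
Proof. by rewrite dotDr dotNr. Qed.

Lemma dot_sqr u : dot u u = \sum_j u ord0 j ^+ 2.
Proof. by []. Qed.

Lemma dot_ge0 u : 0 <= dot u u.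
Proof. by rewrite dot_sqr sumr_ge0// => j _; rewrite sqr_ge0. Qed.

Lemma dot_eq0 u : dot u u = 0 -> u = 0.
Proof.
rewrite dot_sqr => /eqP; rewrite psumr_eq0; last by move=> j _; rewrite sqr_ge0.
move=> /allP h; apply/rowP => j; rewrite mxE; apply/eqP.
by rewrite -sqrf_eq0; apply: h; rewrite mem_index_enum.
Qed.

Lemma dot_gt0 u : u != 0 -> 0 < dot u u.
Proof.
by move=> u0; rewrite lt_def dot_ge0 andbT; apply: contra u0 => /eqP/dot_eq0 ->.
Qed.

Lemma dot_delta u j : dot u (delta_mx ord0 j) = u ord0 j.
Proof.
rewrite /dot (bigD1 j)//= big1 ?addr0 => [|i ij]; rewrite mxE eqxx/=.
  by rewrite eqxx mulr1.
by rewrite (negPf ij) mulr0.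
Qed.

End dot_product.

Section absolutely_convex_hull.
Context (R : realType).

(** Induction on the list: the head is averaged with the normalised tail, with weight
    [a i / (a i + s)]. A tail of zero weight has no normalisation and is dropped. *)
Lemma convex_set_sum (V : lmodType R) (C : set V) (I : eqType) (r : seq I)
    (a : I -> R) (y : I -> V) :
  @convex_set R V C -> (forall i, 0 <= a i) -> (forall i, C (y i)) ->
  0 < \sum_(i <- r) a i ->
  C ((\sum_(i <- r) a i)^-1 *: \sum_(i <- r) a i *: y i).
Proof.
move=> /convex_setP cC a0 Cy; elim: r => [|i r IH]; first by rewrite big_nil ltxx.
rewrite !big_cons; set s := \sum_(j <- r) _; set z := \sum_(j <- r) _.
move=> s0; have s'0 : 0 <= s by apply: sumr_ge0.
have [s_eq0|s_neq0] := eqVneq s 0.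
  have -> : z = 0.
    have : all (fun j => true ==> (a j == 0)) r 
      by have /eqP := s_eq0; rewrite /s psumr_eq0.
    rewrite /z; elim: r {IH s s0 s'0 s_eq0 z} => [|j r IHr]; first by rewrite big_nil.
    by rewrite big_cons/= => /andP[/eqP -> /IHr ->]; rewrite scale0r addr0.
  move: s0; rewrite s_eq0 !addr0 => ai0.
  by rewrite scalerA mulVf ?gt_eqF// scale1r.
have sp : 0 < s by rewrite lt_def s_neq0.
have := cC (y i) (s^-1 *: z) (a i / (a i + s)) (Cy i) (IH sp).
rewrite divr_ge0 ?addr_ge0// ler_pdivrMr// mul1r lerDl => /(_ isT s'0).
congr (C _); rewrite scalerDr !scalerA; congr (_ *: _ + _ *: _); first exact: mulrC.
by field; rewrite !gt_eqF.
Qed.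

Lemma absconv_comb (V : lmodType R) (N : nat) (X : 'I_N -> V) (a : 'I_N -> R) :
  (0 < N)%N -> \sum_i `|a i| <= 1 -> absconv X (\sum_i a i *: X i).
Proof.
move=> N0 a1 C [cC XC].
have XCp i : C (X i) by apply: XC; left; exists i.
have XCn i : C (- X i) by apply: XC; right; exists i.
have C0 : C 0.
  pose i0 := Ordinal N0.
  have := (convex_setP _).1 cC _ _ (1 / 2) (XCp i0) (XCn i0).
  have -> : 1 - 1 / 2 = 1 / 2 :> R by field.
  by rewrite scalerN subrr; apply; lra.
(* The missing weight is put on the origin, under the index [None], to obtain a true convex
   combination. *)
pose b (o : option 'I_N) := if o is Some i then `|a i| else 1 - \sum_i `|a i|.
pose y (o : option 'I_N) := if o is Some i then Num.sg (a i) *: X i else 0.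
have sb : \sum_o b o = 1.
  rewrite (bigD1 None)//= (reindex_omap Some id) => [|[i|]]//=.
  by under [X in _ + X]eq_bigl => j do rewrite eqxx; rewrite subrK.
have := @convex_set_sum V C _ (index_enum (option 'I_N)) b y cC.
rewrite sb invr1 scale1r.
have -> : \sum_o b o *: y o = \sum_i a i *: X i.
  rewrite (bigD1 None)//= scaler0 add0r (reindex_omap Some id) => [|[i|]]//=.
  under eq_bigr => i _ do rewrite scalerA mulrC -numEsg.
  by apply: eq_bigl => i; rewrite eqxx.
apply => //.
- by case => [i|] //=; rewrite subr_ge0.
- case => [i|] //=; have [a0|a0|->] := ltgtP (a i) 0.
  + by rewrite ltr0_sg// scaleN1r.
  + by rewrite gtr0_sg// scale1r.
  + by rewrite sgr0 scale0r.
Qed.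

(** The open half-space below the level [dot v u] is convex and contains all [X i] and [- X i], but
    not [v]. *)
Lemma absconv_support (n N : nat) (X : 'I_N -> 'rV[R]_n) (u v : 'rV[R]_n) :
  (forall i, `|dot (X i) u| < dot v u) -> ~ absconv X v.
Proof.
move=> h hv; suff : dot v u < dot v u by rewrite ltxx.
apply: (hv [set y | dot y u < dot v u]); split.
  apply/convex_setP => x y l /= hx hy l0 l1; rewrite dotDl !dotZl.
  have [->|l'] := eqVneq l 0; first by lra.
  have lp : 0 < l by rewrite lt_def l'.
  have : l * dot x u < l * dot v u by rewrite ltr_pM2l.
  have : (1 - l) * dot y u <= (1 - l) * dot v u.
    by rewrite ler_wpM2l ?subr_ge0//; exact: ltW.
  by lra.
move=> y [[i _ <-]|[i _ <-]] /=; have := h i; rewrite ltr_norml ?dotNl => /andP[]; lra.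
Qed.

Lemma continuous_sum (T : topologicalType) (I : Type) (r : seq I) (f : I -> T -> R) :
  (forall i, continuous (f i)) -> continuous (fun x => \sum_(i <- r) f i x).
Proof.
move=> cf; elim: r => [|i r IH] x.
  under eq_fun do rewrite big_nil.
  exact: cvg_cst.
under eq_fun do rewrite big_cons.
by apply: cvgD; [exact: cf|exact: IH].
Qed.

Lemma continuous_comb (N n : nat) (X : 'I_N -> 'rV[R]_n) (v : 'rV[R]_n) :
  continuous (fun a : 'rV[R]_N =>
    dot (v - \sum_i a ord0 i *: X i) (v - \sum_i a ord0 i *: X i)).
Proof.
have -> : (fun a : 'rV[R]_N =>
    dot (v - \sum_i a ord0 i *: X i) (v - \sum_i a ord0 i *: X i)) =
  (fun a : 'rV[R]_N => \sum_j (v ord0 j - \sum_i a ord0 i * X i ord0 j) ^+ 2).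
  apply/funext => a; rewrite dot_sqr; apply: eq_bigr => j _.
  by rewrite !mxE summxE; congr ((_ - _) ^+ 2); apply: eq_bigr => i _; rewrite mxE.
apply: continuous_sum => j a.
apply: (@continuous_comp _ _ _
  (fun a : 'rV[R]_N => v ord0 j - \sum_i a ord0 i * X i ord0 j) (fun x : R => x ^+ 2));
  last exact: exprn_continuous.
have cs : continuous (fun a : 'rV[R]_N => \sum_i a ord0 i * X i ord0 j).
  apply: continuous_sum => i b.
  have ci : continuous (fun a : 'rV[R]_N => a ord0 i) by exact: coord_continuous.
  exact: (cvgM (ci b) (cvg_cst _)).
exact: (cvgB (cvg_cst _) (cs a)).
Qed.

Lemma compact_cross_polytope (N : nat) :
  compact [set a : 'rV[R]_N | \sum_i `|a ord0 i| <= 1].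
Proof.
apply: bounded_closed_compact.
  exists 1; split; first exact: num_real.
  move=> M M1 a /= a1; rewrite [leLHS]/Num.norm/= mx_normrE.
  apply/bigmax_leP; split; first by lra.
  move=> [i j] _ /=; rewrite ord1; apply: le_trans (ltW M1); apply: le_trans a1.
  by rewrite (bigD1 j)//= lerDl sumr_ge0.
have cf : continuous (fun a : 'rV[R]_N => \sum_i `|a ord0 i|).
  apply: continuous_sum => i a.
  have ci : continuous (fun a : 'rV[R]_N => a ord0 i) by exact: coord_continuous.
  exact: (cvg_norm (ci a)).
have := @closed_comp _ _ _ [set x : R | x <= 1] (fun a _ => cf a) (@closed_le R 1).
by [].
Qed.

(** Nearest-point projection: [L a] minimises the distance to [v] over coefficients in the compact
    cross-polytope, and [w = v - L a] separates. *)
Lemma absconv_separation (n N : nat) (X : 'I_N -> 'rV[R]_n) (v : 'rV[R]_n) :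
  (0 < N)%N -> ~ absconv X v -> exists u, forall i, `|dot (X i) u| < dot v u.
Proof.
move=> N0 vX.
pose L (a : 'rV[R]_N) := \sum_i a ord0 i *: X i.
pose A := [set a : 'rV[R]_N | \sum_i `|a ord0 i| <= 1].
have A0 : A !=set0 by exists 0; rewrite /A/= big1// => i _; rewrite mxE normr0.
have [a aA amin] : exists2 a, a \in A &
    forall b, b \in A -> dot (v - L a) (v - L a) <= dot (v - L b) (v - L b).
  apply: (EVT_min_rV A0 (@compact_cross_polytope N)).
  by apply: continuous_subspaceT; exact: continuous_comb.
rewrite inE /A/= in aA.
pose w := v - L a.
have w0 : 0 < dot w w.
  apply: dot_gt0; rewrite subr_eq0; apply/eqP => vE; apply: vX.
  by rewrite vE; apply: absconv_comb.
(* Optimality on the segment from [a] to [b]: a positive [dot z w] would let a small move bring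
   [L a] closer to [v]. *)
have first_order b : A b -> dot (L b - L a) w <= 0.
  move=> Ab; rewrite leNgt; apply/negP => z0.
  pose z := L b - L a.
  have key (t : R) : 0 <= t -> t <= 1 -> 2 * t * dot z w <= t ^+ 2 * dot z z.
    move=> t0 t1; have := amin (a + t *: (b - a)).
    have -> : L (a + t *: (b - a)) = L a + t *: z.
      rewrite /L /z /L -sumrB scaler_sumr -big_split/=; apply: eq_bigr => i _.
      by rewrite !mxE -scalerBl scalerA -scalerDl.
    have -> : v - (L a + t *: z) = w - t *: z by rewrite opprD addrA.
    rewrite inE -/w => h.
    have : A (a + t *: (b - a)).
      rewrite /A/=; apply: (@le_trans _ _ (\sum_i ((1 - t) * `|a ord0 i| + t * `|b ord0 i|))).
        apply: ler_sum => i _; rewrite !mxE.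
        have -> : a ord0 i + t * (b ord0 i - a ord0 i) =
          (1 - t) * a ord0 i + t * b ord0 i by ring.
        rewrite (le_trans (ler_normD _ _))// !normrM (ger0_norm t0).
        by rewrite (ger0_norm (_ : 0 <= 1 - t))// subr_ge0.
      rewrite big_split/= -!mulr_sumr.
      have : (1 - t) * \sum_i `|a ord0 i| <= 1 - t by rewrite ler_piMr ?subr_ge0.
      have : t * \sum_i `|b ord0 i| <= t by rewrite ler_piMr.
      by lra.
    move=> /h; rewrite (dotBl w (t *: z)) !(dotBr _ w (t *: z)).
    rewrite !(dotZl t z) !(dotZr t _ z) (dotC w z).
    by lra.
  have zz : 0 < dot z z.
    have := key 1 ler01 (lexx 1); have : 0 < dot z w by [].
    by lra.
  (* The minimiser [dot z w / dot z z] of the quadratic contradicts [key]; if it exceeds 1, the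
     endpoint [t = 1] already does. *)
  have [h|h] := leP (dot z w) (dot z z).
    have t0 : 0 <= dot z w / dot z z by rewrite divr_ge0 ?dot_ge0// ltW.
    have t1 : dot z w / dot z z <= 1 by rewrite ler_pdivrMr// mul1r.
    have := key _ t0 t1.
    have -> : 2 * (dot z w / dot z z) * dot z w = 2 * (dot z w ^+ 2 / dot z z) by ring.
    have -> : (dot z w / dot z z) ^+ 2 * dot z z = dot z w ^+ 2 / dot z z.
      by field; rewrite gt_eqF.
    have : 0 < dot z w ^+ 2 / dot z z by rewrite divr_gt0// exprn_gt0.
    by lra.
  have := key 1 ler01 (lexx 1); have : 0 < dot z w by [].
  by lra.
exists w => i.
have vw : dot v w = dot (L a) w + dot w w by rewrite -dotDl /w addrCA subrr addr0.
(* The vertices of the cross-polytope are the test points; strictness then comes from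
   [dot w w > 0]. *)
have e1 (s : R) : `|s| <= 1 -> s * dot (X i) w <= dot (L a) w.
  move=> s1; have := first_order (s *: delta_mx ord0 i).
  have -> : L (s *: delta_mx ord0 i) = s *: X i.
    rewrite /L (bigD1 i)//= big1 ?addr0 => [|j ji]; rewrite !mxE eqxx/=.
      by rewrite eqxx mulr1.
    by rewrite (negPf ji) mulr0 scale0r.
  rewrite dotBl dotZl subr_le0; apply.
  rewrite /A/= (bigD1 i)//= big1 ?addr0 => [|j ji]; rewrite !mxE eqxx/=.
    by rewrite eqxx mulr1.
  by rewrite (negPf ji) mulr0 normr0.
have := e1 1; have := e1 (-1); rewrite normrN normr1 => /(_ (lexx 1)) ? /(_ (lexx 1)) ?.
by rewrite ltr_norml; apply/andP; split; lra.
Qed.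

End absolutely_convex_hull.

(** * Vertices of the polar *)

Section vertex.
Context (R : realType) (n : nat) (F : finType) (Z : F -> 'rV[R]_n) (v : 'rV[R]_n).
Hypothesis Zspan : forall u, (forall i, dot (Z i) u = 0) -> u = 0.

(** A point of the polar of the [Z i] and [- Z i] that still certifies that [v] is outside their
    hull. *)
Let feasible (th : 'rV[R]_n) := (forall i, `|dot (Z i) th| <= 1) /\ 1 < dot v th.
Let tight (th : 'rV[R]_n) (i : F) := `|dot (Z i) th| == 1.
(** Constraints that are not tight give zero rows: the size stays fixed while the rank measures the
    span of the tight points. *)
Let M (th : 'rV[R]_n) : 'M[R]_(#|F|, n) :=
  \matrix_(k < #|F|) (if tight th (enum_val k) then Z (enum_val k) else 0).

Let M_tr th u k : (M th *m u^T) k ord0 =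
  if tight th (enum_val k) then dot (Z (enum_val k)) u else 0.
Proof.
rewrite mxE; case: ifP => h.
  by apply: eq_bigr => j _; rewrite !mxE h.
by rewrite big1// => j _; rewrite !mxE h mxE mul0r.
Qed.

Let M_ker th u : M th *m u^T = 0 <-> forall i, tight th i -> dot (Z i) u = 0.
Proof.
split => [/matrixP h i ti|h].
  by have := h (enum_rank i) ord0; rewrite M_tr enum_rankK ti mxE.
apply/matrixP => k l; rewrite ord1 M_tr mxE; case: ifP => //; exact: h.
Qed.

(** Moving along [u] leaves the tight constraints unchanged and does not decrease [dot v]; the
    motion stops when the first new constraint becomes tight. *)
Let move_step th u i0 : feasible th -> (forall i, tight th i -> dot (Z i) u = 0) ->
  dot (Z i0) u != 0 -> 0 <= dot v u ->
  exists th', [/\ feasible th', forall i, tight th i -> tight th' i &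
    exists2 i, tight th' i & dot (Z i) u != 0].
Proof.
move=> [th1 thv] hu hi0 vu.
(* The time at which [dot (Z i)] reaches 1 or -1 along the ray; the minimum is taken over the
   constraints that vary. *)
pose t i := (1 - Num.sg (dot (Z i) u) * dot (Z i) th) / `|dot (Z i) u|.
have sgd i : `|Num.sg (dot (Z i) u) * dot (Z i) th| <= 1.
  rewrite normrM normr_sg; apply: le_trans (th1 i).
  by case: (_ != 0); rewrite ?mul1r ?mul0r.
have t0 i : 0 <= t i.
  by rewrite divr_ge0// subr_ge0; have := sgd i; rewrite ler_norml => /andP[].
have [i /= zi imin] := @Order.TotalTheory.arg_minP _ _ _ i0 [pred i | dot (Z i) u != 0] t hi0.
have dotE j : dot (Z j) (th + t i *: u) = dot (Z j) th + t i * dot (Z j) u.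
  by rewrite dotDr dotZr.
exists (th + t i *: u); split.
- split; last first.
    by rewrite dotDr dotZr (lt_le_trans thv)// lerDl mulr_ge0.
  move=> j; rewrite dotE; have [->|zj] := eqVneq (dot (Z j) u) 0.
    by rewrite mulr0 addr0.
  have sn : `|Num.sg (dot (Z j) u)| = 1 by rewrite normr_sg zj.
  rewrite -[leLHS]mul1r -sn -normrM mulrDr mulrCA -normrEsg.
  have := imin j zj; rewrite /t -/(t i) ler_pdivlMr ?normr_gt0// => h.
  have : 0 <= t i * `|dot (Z j) u| by rewrite mulr_ge0.
  have := sgd j; rewrite !ler_norml => /andP[] a b c; apply/andP; split; lra.
- by move=> j tj; rewrite /tight dotE (hu j tj) mulr0 addr0.
- exists i => //; rewrite /tight dotE.
  have sn : `|Num.sg (dot (Z i) u)| = 1 by rewrite normr_sg zi.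
  have h : Num.sg (dot (Z i) u) * (dot (Z i) th + t i * dot (Z i) u) = 1.
    by rewrite mulrDr mulrCA -normrEsg /t divfK ?normr_eq0// addrC subrK.
  by apply/eqP; rewrite -[LHS]mul1r -{1}sn -normrM h normr1.
Qed.

Let rank_step th : feasible th ->
  ~ (forall u, (forall i, tight th i -> dot (Z i) u = 0) -> u = 0) ->
  exists2 th', feasible th' & (\rank (M th) < \rank (M th'))%N.
Proof.
move=> fth /existsNP[u /not_implyP[hu /eqP u0]].
have [i0 hi0] : exists i, dot (Z i) u != 0.
  apply/not_existsP => h; move/eqP: u0; apply; apply: Zspan => i.
  by have := h i; move/negP; rewrite negbK => /eqP.
have [th' [fth' sub [i ti zi]]] : exists th', [/\ feasible th',
    forall i, tight th i -> tight th' i & exists2 i, tight th' i & dot (Z i) u != 0].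
  (* One of [u] and [- u] does not decrease [dot v]. *)
  have [vu|vu] := leP 0 (dot v u); first exact: (move_step fth hu hi0).
  have [||| th' [f s [i ti zi]]] := @move_step th (- u) i0 fth.
  - by move=> i /hu; rewrite dotNr => ->; rewrite oppr0.
  - by rewrite dotNr oppr_eq0.
  - by rewrite dotNr oppr_ge0 ltW.
  - by exists th'; split=> //; exists i => //; move: zi; rewrite dotNr oppr_eq0.
exists th' => //.
have le : (M th <= M th')%MS.
  apply/row_subP => k; rewrite rowK; case: ifP => [tk|_]; last exact: sub0mx.
  have -> : Z (enum_val k) = row k (M th') by rewrite rowK (sub _ tk).
  exact: row_sub.
(* With equal ranks the rows of [M th'] would lie in the span of those of [M th], hence annihilate
   [u], against the newly tight point. *)
rewrite ltn_neqAle (mxrankS le) andbT; apply/negP => eqr.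
have := mxrank_leqif_sup le => -[_]; rewrite eqr => /esym/submxP[D DE].
have : M th' *m u^T = 0 by rewrite DE -mulmxA (M_ker th u).2 ?mulmx0.
by move/M_ker/(_ i ti)/eqP; exact/negP.
Qed.

Let vertex_basis th : feasible th ->
  (forall u, (forall i, tight th i -> dot (Z i) u = 0) -> u = 0) ->
  exists2 J : {set F}, #|J| = n & (forall i, i \in J -> tight th i) /\
    (forall u, (forall i, i \in J -> dot (Z i) u = 0) -> u = 0).
Proof.
move=> fth ker0.
have full : row_full (M th).
  rewrite /row_full -mxrank_tr -[_ == _]/(row_free _) -kermx_eq0.
  apply/eqP/row_matrixP => k; rewrite row0.
  apply: ker0; apply/M_ker.
  apply: trmx_inj; rewrite trmx_mul trmxK trmx0.
  by rewrite -row_mul mulmx_ker row0.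
pose f := fullrankfun full.
pose g k := enum_val (f k).
have ginj : injective g by move=> k l /enum_val_inj /(@fullrankfun_inj _ _ _ _ full).
have unitf : rowsub f (M th) \in unitmx by exact: fullrowsub_unit.
(* An invertible submatrix has no zero row, so all selected constraints are tight. *)
have gt k : tight th (g k).
  apply/negPn/negP => nt.
  have : row k (rowsub f (M th)) = 0.
    by apply/rowP => j; rewrite !mxE -/(g k) (negPf nt) mxE.
  have e : row k (rowsub f (M th)) *m invmx (rowsub f (M th)) = delta_mx ord0 k.
    by rewrite -row_mul mulmxV// row1.
  move=> r0; move: e; rewrite r0 mul0mx => /rowP/(_ k).
  by rewrite !mxE !eqxx => /eqP; rewrite eq_sym oner_eq0.
exists (g @: [set: 'I_n]%SET)%SET; first by rewrite card_imset// cardsT card_ord.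
split; first by move=> i /imsetP[k _ ->].
move=> u hu.
have : rowsub f (M th) *m u^T = 0.
  apply/matrixP => k l; rewrite ord1 mxE [RHS]mxE.
  rewrite -[RHS](hu (g k)) ?imset_f//; apply: eq_bigr => j _.
  by rewrite !mxE -/(g k) gt.
move=> /(congr1 (mulmx (invmx (rowsub f (M th))))); rewrite mulKmx// mulmx0.
by move=> /(congr1 trmx); rewrite trmxK trmx0.
Qed.

Lemma vertex_exists th : (forall i, `|dot (Z i) th| <= 1) -> 1 < dot v th ->
  exists th', [/\ forall i, `|dot (Z i) th'| <= 1, 1 < dot v th' &
    exists2 J : {set F}, #|J| = n & (forall i, i \in J -> `|dot (Z i) th'| = 1) /\
      (forall u, (forall i, i \in J -> dot (Z i) u = 0) -> u = 0)].
Proof.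
move=> th1 thv.
(* Induction on the corank of the tight constraints, which [rank_step] strictly decreases. *)
have [m] := ubnP (n - \rank (M th))%N.
have : feasible th by [].
elim: m th {th1 thv} => // m IH th fth hm.
have [ker0|/(rank_step fth)[th' fth' lt]] :=
    pselect (forall u, (forall i, tight th i -> dot (Z i) u = 0) -> u = 0).
  exists th; split; [exact: fth.1|exact: fth.2|].
  have [J Jn [Jt Jk]] := vertex_basis fth ker0.
  by exists J => //; split => // i /Jt /eqP.
apply: (IH th') => //; rewrite ltnS in hm.
apply: leq_trans hm; rewrite ltn_sub2l//.
by rewrite (leq_trans lt)// rank_leq_col.
Qed.

End vertex.

(** * Lower tail bound in a fixed direction *)

Section integral_comparison.
Context (R : realType) (d : measure_display) (T : measurableType d)
  (P : probability T R).

Let integral_comb (I : finType) (c : I -> R) (f : I -> T -> R) (m : I -> R) :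
  (forall i, 0 <= c i) -> (forall i t, 0 <= f i t) ->
  (forall i, measurable_fun setT (f i)) ->
  (forall i, (\int[P]_t (f i t)%:E = (m i)%:E)%E) ->
  (\int[P]_t (\sum_i c i * f i t)%:E = (\sum_i c i * m i)%:E)%E.
Proof.
move=> c0 f0 mf fm.
under eq_integral => t _ do rewrite -sumEFin.
rewrite ge0_integral_sum//; last 2 first.
- move=> i; apply/measurable_EFinP; apply: measurable_funM => //.
- by move=> i t _; rewrite lee_fin mulr_ge0.
rewrite -sumEFin; apply: eq_bigr => i _.
under eq_integral => t _ do rewrite EFinM.
rewrite ge0_integralZl_EFin ?fm//.
- by move=> t _; rewrite lee_fin.
- exact/measurable_EFinP.
Qed.

(** Integrates a pointwise inequality between nonnegative combinations. Markov-type bounds and the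
    average over signs all take this form. *)
Lemma le_integral_comb (I J : finType) (c : I -> R) (f : I -> T -> R) (m : I -> R)
    (b : J -> R) (g : J -> T -> R) (l : J -> R) :
  (forall i, 0 <= c i) -> (forall i t, 0 <= f i t) ->
  (forall i, measurable_fun setT (f i)) ->
  (forall i, (\int[P]_t (f i t)%:E = (m i)%:E)%E) ->
  (forall j, 0 <= b j) -> (forall j t, 0 <= g j t) ->
  (forall j, measurable_fun setT (g j)) ->
  (forall j, (\int[P]_t (g j t)%:E = (l j)%:E)%E) ->
  (forall t, \sum_i c i * f i t <= \sum_j b j * g j t) ->
  \sum_i c i * m i <= \sum_j b j * l j.
Proof.
move=> c0 f0 mf fm b0 g0 mg gl fg.
rewrite -lee_fin -(integral_comb c0 f0 mf fm) -(integral_comb b0 g0 mg gl).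
apply: ge0_le_integral => //.
- by move=> t _; rewrite lee_fin sumr_ge0// => i _; rewrite mulr_ge0.
- apply/measurable_EFinP; apply: measurable_sum => i.
  exact: measurable_funM.
- apply/measurable_EFinP; apply: measurable_sum => i.
  exact: measurable_funM.
- by move=> t _; rewrite lee_fin.
Qed.

Lemma integral_indicT (A : set T) : measurable A ->
  (\int[P]_t (\1_A t)%:E = (fine (P A))%:E)%E.
Proof. by move=> mA; rewrite integral_indic// setIT fineK// fin_num_measure. Qed.

End integral_comparison.

(** * Tail of a linear form by symmetrisation *)

Section tail.
Context (R : realType) (d0 d1 : measure_display)
  (T0 : measurableType d0) (P0 : probability T0 R)
  (T1 : measurableType d1) (P1 : probability T1 R)
  (n : nat) (x : {RV P0 >-> R}) (X : {RV P1 >-> n.-tuple R}) (gamma delta : R).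
Hypothesis gamma0 : 0 < gamma.
Hypothesis delta0 : 0 < delta.
Hypothesis xsym : symmetric_rv P0 x.
Hypothesis xvar : ('E_P0[(fun t => (x t ^+ 2)%R)] = 1)%E.
Hypothesis xsmall : (delta%:E <= P0 [set t | (gamma <= `|x t|)%R])%E.
Hypothesis Xcop : independent_copies P0 P1 x (fun (j : 'I_n) t => tnth (X t) j).

Let mX j : measurable_fun setT (fun t => tnth (X t) j).
Proof. by apply: (measurableT_comp (measurable_tnth j)). Qed.

Let Xlaw j (A : set R) : measurable A -> P1 ((fun t => tnth (X t) j) @^-1` A) = P0 (x @^-1` A).
Proof. by move=> mA; have [_ /(_ j _ mA)] := Xcop. Qed.

Let flip (e : {ffun 'I_n -> bool}) (t : T1) : n.-tuple R :=
  [tuple rad R (e j) * tnth (X t) j | j < n].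

Let mflip e : measurable_fun setT (flip e).
Proof.
apply/measurable_fun_tnthP => j.
rewrite (_ : _ \o _ = (fun t => rad R (e j) * tnth (X t) j)).
  exact: measurable_funM.
by apply/funext => t /=; rewrite tnth_mktuple.
Qed.

(** By symmetry and independence fixed sign changes preserve the law; boxes suffice for the
    check. *)
Let flip_law e (U : set (n.-tuple R)) : measurable U ->
  P1 (flip e @^-1` U) = P1 (X @^-1` U).
Proof.
move=> mU.
pose fe : {mfun T1 >-> n.-tuple R} :=
  HB.pack (flip e) (isMeasurableFun.Build _ _ _ _ (flip e) (mflip e)).
apply: (@tuple_measure_unique R _ _ n (distribution P1 fe) (distribution P1 X)) => //.
  by rewrite /= /distribution /pushforward preimage_setT probability_setT ltry.
move=> A mA.
have mrad b : measurable_fun setT (fun y : R => rad R b * y) by exact: measurable_funM.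
have mB j : measurable ((fun y : R => rad R (e j) * y) @^-1` A j).
  by rewrite -[X in measurable X]setTI; exact: mrad.
have [ind _] := Xcop.
transitivity (P1 [set t | forall i,
    ((fun y : R => rad R (e i) * y) @^-1` A i) (tnth (X t) i)]).
  congr (P1 _).
  by apply/seteqP; split => t /= h i; have := h i; rewrite tnth_mktuple.
transitivity (P1 [set t | forall i, A i (tnth (X t) i)]); last by [].
rewrite (ind _ mB) (ind _ mA); apply: eq_bigr => j _.
rewrite !Xlaw//= /rad; case: (e j).
  by congr (P0 _); apply/seteqP; split => t /=; rewrite mul1r.
have /= := xsym (mA j); rewrite /pushforward => ->.
by congr (P0 _); apply/seteqP; split => t /=; rewrite mulN1r.
Qed.

Let msq j : measurable_fun setT (fun t => tnth (X t) j ^+ 2).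
Proof. by apply: measurable_funX. Qed.

Let Xvar j : (\int[P1]_t (tnth (X t) j ^+ 2)%:E = 1%:E)%E.
Proof.
pose Xj : {mfun T1 >-> R} := HB.pack (fun t => tnth (X t) j)
  (isMeasurableFun.Build _ _ _ _ (fun t => tnth (X t) j) (mX j)).
have msqr : measurable_fun setT (fun y : R => (y ^+ 2)%:E).
  by apply/measurable_EFinP; exact: measurable_funX.
have sq0 (y : R) : (0 <= (y ^+ 2)%:E)%E by rewrite lee_fin sqr_ge0.
have -> : (\int[P1]_t (tnth (X t) j ^+ 2)%:E =
    \int[distribution P1 Xj]_y (y ^+ 2)%:E)%E.
  by rewrite ge0_integral_distribution.
have <- : (\int[distribution P0 x]_y (y ^+ 2)%:E = 1%:E)%E.
  by rewrite ge0_integral_distribution//= -xvar unlock.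
by apply: eq_measure_integral => A mA _; exact: Xlaw.
Qed.

Let mabs j : measurable [set t | gamma <= `|tnth (X t) j|].
Proof.
rewrite -[X in measurable X]setTI; apply: measurable_fun_le => //.
by apply: measurableT_comp (mX j).
Qed.

Let Xsmall j : delta <= fine (P1 [set t | gamma <= `|tnth (X t) j|]).
Proof.
rewrite -lee_fin fineK ?fin_num_measure//; apply: le_trans xsmall _.
rewrite le_eqVlt; apply/orP; left; apply/eqP.
have mA : measurable [set y : R | gamma <= `|y|].
  rewrite -[X in measurable X]setTI.
  apply: (@measurable_fun_le _ _ _ setT (fun=> gamma) (fun y : R => `|y|)) => //.
by have := Xlaw j mA; rewrite /preimage/= => ->.
Qed.

Variables (th v : 'I_n -> R) (k : R).
Hypothesis v1 : forall j, `|v j| <= 1.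
Hypothesis vk : \sum_j v j ^+ 2 <= k.
Let a : R := \sum_j `|v j| * `|th j|.
Hypothesis a0 : 0 < a.
Hypothesis tha : \sum_j th j ^+ 2 <= a ^+ 2.

Let c j : R := `|v j| * `|th j|.
Let c0 j : 0 <= c j. Proof. by rewrite mulr_ge0. Qed.

(** [gamma * mass] bounds from below the quantity [A] of [rademacher_tail] for the coefficients
    [th j * tnth (X t) j], and [energy] equals its [B]. *)
Let mass t : R := \sum_j c j * \1_[set t | gamma <= `|tnth (X t) j|] t.
Let energy t : R := \sum_j th j ^+ 2 * tnth (X t) j ^+ 2.

Let mmass : measurable_fun setT mass.
Proof. by apply: measurable_sum => j; apply: measurable_funM => //; exact: measurable_indic. Qed.

Let menergy : measurable_fun setT energy.
Proof. by apply: measurable_sum => j; apply: measurable_funM. Qed.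

Let H := [set t | delta / 2 * a <= mass t].
Let L := [set t | energy t <= 4 / delta * a ^+ 2].

Let mH : measurable H.
Proof. by rewrite -[H]setTI; exact: measurable_fun_le. Qed.

Let mL : measurable L.
Proof. by rewrite -[L]setTI; exact: measurable_fun_le. Qed.

(** Reverse Markov inequality: [mass] never exceeds [a] and has mean at least [delta * a]. *)
Let massive : delta / 2 <= fine (P1 H).
Proof.
have := @le_integral_comb R _ _ P1 'I_n bool c
  (fun j => \1_[set t | gamma <= `|tnth (X t) j|])
  (fun j => fine (P1 [set t | gamma <= `|tnth (X t) j|]))
  (fun b => if b then a else delta / 2 * a)
  (fun b => if b then \1_H else \1_setT) (fun b => if b then fine (P1 H) else 1).
rewrite !big_bool/= mulr1 => h.
have : \sum_i c i * fine (P1 [set t | gamma <= `|tnth (X t) i|]) <=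
    a * fine (P1 H) + delta / 2 * a.
  apply: h => //.
  - by move=> j; exact: integral_indicT.
  - by case; rewrite ?(ltW a0)// mulr_ge0 ?divr_ge0 ?ltW.
  - by case=> t; rewrite indicE.
  - by case; apply: measurable_indic.
  - by case; rewrite integral_indicT// probability_setT.
  - move=> t; rewrite big_bool/= -/(mass t) indicT mulr1.
    rewrite indicE; have [Ht|Ht] := pselect (H t).
      rewrite mem_set// mulr1; apply: (@le_trans _ _ a).
        apply: ler_sum => j _; rewrite ler_piMr// indicE lern1 leq_b1.
      by rewrite lerDl mulr_ge0 ?divr_ge0 ?ltW.
    rewrite memNset// mulr0 add0r; apply: ltW; rewrite ltNge; exact/negP.
have : delta * a <= \sum_i c i * fine (P1 [set t | gamma <= `|tnth (X t) i|]).
  rewrite /a mulr_sumr; apply: ler_sum => j _.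
  by rewrite mulrC ler_wpM2l.
move=> h1 h2; rewrite -(ler_pM2l a0); lra.
Qed.

(** Markov's inequality: the mean energy is at most [a ^+ 2]. The factor [4 / delta] makes the loss
    half of the mass guaranteed for [H]. *)
Let lowenergy : 1 - delta / 4 <= fine (P1 L).
Proof.
have := @le_integral_comb R _ _ P1 unit 'I_n (fun=> 4 / delta * a ^+ 2)
  (fun=> \1_(~` L)) (fun=> fine (P1 (~` L)))
  (fun j => th j ^+ 2) (fun j t => tnth (X t) j ^+ 2) (fun=> 1).
rewrite !big_const/= card_unit/= addr0 => h.
have : 4 / delta * a ^+ 2 * fine (P1 (~` L)) <= \sum_j th j ^+ 2 * 1.
  apply: h => //.
  - by move=> _; rewrite mulr_ge0 ?divr_ge0 ?sqr_ge0 ?ltW.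
  - by move=> _; apply: measurable_indic; exact: measurableC.
  - by move=> _; apply: integral_indicT; exact: measurableC.
  - by move=> j; rewrite sqr_ge0.
  - by move=> j t; rewrite sqr_ge0.
  - move=> t; rewrite -/(energy t) big_const card_unit/= addr0 indicE.
    have [Lt|Lt] := pselect (L t).
      rewrite memNset ?mulr0; first by apply: sumr_ge0 => j _; rewrite mulr_ge0 ?sqr_ge0.
      by move/(_ Lt).
    by rewrite mem_set// mulr1; apply: ltW; rewrite ltNge; exact/negP.
under eq_bigr do rewrite mulr1.
move=> /le_trans /(_ tha).
have -> : fine (P1 (~` L)) = 1 - fine (P1 L).
  by rewrite probability_setC// fineB ?fin_num_measure.
have a20 : 0 < a ^+ 2 by rewrite exprn_gt0.
rewrite (_ : 4 / delta * a ^+ 2 * (1 - fine (P1 L)) =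
  a ^+ 2 * ((1 - fine (P1 L)) * 4 / delta)); last by ring.
rewrite -[leRHS]mulr1 ler_pM2l// ler_pdivrMr// mul1r.
by move=> h2; rewrite lerBlDr -lerBlDl ler_pdivlMr.
Qed.

(** The ratio of [(gamma * delta / 2 * a) ^+ 2], a lower bound for [A ^+ 2], to
    [4 / delta * a ^+ 2], an upper bound for [B]. *)
Let kap := gamma ^+ 2 * delta ^+ 3 / 16.

(** For each outcome in [H] and [L], a proportion of at least [p] of the sign flips is large. Since
    all flips have the same law, averaging over them bounds the probability for [X] itself. *)
Lemma tail_lower_bound :
  ((delta / 4 * ((kap / (16 + 4 * kap)) ^+ 2 * expR (- (k / 4))))%:E <=
    P1 [set t | (gamma * delta / 8 * a < \sum_j th j * tnth (X t) j)%R])%E.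
Proof.
pose G := H `&` L.
have mG : measurable G by exact: measurableI.
have PG : delta / 4 <= fine (P1 G).
  have e : (P1 H + P1 L <= P1 G + 1)%E.
    rewrite -(probability_setT P1).
    have -> : (P1 H = P1 G + P1 (H `\` L))%E by rewrite addeC /G -measureDI.
    rewrite -addeA leeD2l// addeC -measureU//; last 2 first.
    - exact: measurableD.
    - by apply/seteqP; split => t //= -[? []].
    by apply: le_measure; rewrite ?inE//; apply: measurableU => //; exact: measurableD.
  move: e; rewrite -(fineK (fin_num_measure P1 _ mH)) -(fineK (fin_num_measure P1 _ mL)).
  rewrite -(fineK (fin_num_measure P1 _ mG)) -!EFinD lee_fin.
  by have := massive; have := lowenergy; lra.
pose p := (kap / (16 + 4 * kap)) ^+ 2 * expR (- (k / 4)).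
(* A quarter of the lower bound for [A], matching the threshold [A / 4] of [rademacher_tail]. *)
pose s := gamma * delta / 8 * a.
pose S (e : {ffun 'I_n -> bool}) t := \sum_j th j * tnth (X t) j * rad R (e j).
pose W := [set y : n.-tuple R | s < \sum_j th j * tnth y j].
have mW : measurable W.
  rewrite -[W]setTI; apply: measurable_fun_ltr => //.
  apply: measurable_sum => j; apply: measurable_funM => //.
  exact: measurable_tnth.
have WE e : [set t | s < S e t] = flip e @^-1` W.
  have SE t : S e t = \sum_j th j * tnth (flip e t) j.
    by apply: eq_bigr => j _; rewrite tnth_mktuple -mulrA [X in _ * X]mulrC.
  by apply/seteqP; split => t /=; rewrite SE.
have mS e : measurable [set t | s < S e t].
  by rewrite WE -[X in measurable X]setTI; exact: mflip.
have kap0 : 0 < kap by rewrite divr_gt0// mulr_gt0// exprn_gt0.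
have p0 : 0 <= p by rewrite mulr_ge0 ?sqr_ge0 ?expR_ge0.
(* Here the outcome [t] is frozen and only the signs [e] vary. *)
have count t : G t -> p * 2 ^+ n <= #|[pred e | s < S e t]|%:R.
  move=> [Ht Lt].
  have /= := @rademacher_tail R n (fun j => th j * tnth (X t) j) v k v1 vk.
  set A := \sum_j `|v j| * `|th j * _|; set B := \sum_j (th j * _) ^+ 2.
  have A1 : gamma * delta / 2 * a <= A.
    apply: (@le_trans _ _ (gamma * mass t)).
      by rewrite -mulrA -mulrA ler_pM2l// mulrA.
    rewrite /mass /A mulr_sumr; apply: ler_sum => j _.
    rewrite mulrCA normrM [leRHS]mulrA -/(c j) ler_wpM2l// indicE.
    have [g|g] := leP gamma `|tnth (X t) j|.
      by rewrite mem_set// mulr1.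
    by rewrite memNset ?mulr0//= leNgt g.
  have A0 : 0 < A by rewrite (lt_le_trans _ A1)// !mulr_gt0 ?invr_gt0.
  have B1 : B <= 4 / delta * a ^+ 2.
    by apply: le_trans Lt; apply: ler_sum => j _; rewrite exprMn.
  have B0 : 0 <= B by apply: sumr_ge0 => j _; rewrite sqr_ge0.
  have AB : kap * B <= A ^+ 2.
    apply: (@le_trans _ _ ((gamma * delta / 2 * a) ^+ 2)); last first.
      by rewrite lerXn2r// nnegrE ltW// !mulr_gt0 ?invr_gt0.
    apply: (@le_trans _ _ (kap * (4 / delta * a ^+ 2))); first by rewrite ler_pM2l.
    rewrite le_eqVlt; apply/orP; left; apply/eqP; rewrite /kap.
    by field; rewrite gt_eqF.
  move=> /(_ A0) le1; apply: (@le_trans _ _ _ _ _ _ (le_trans le1 _)).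
    apply: ler_wpM2r; first by rewrite exprn_ge0.
    apply: ler_wpM2r; first by rewrite expR_ge0.
    have A20 : 0 < A ^+ 2 by rewrite exprn_gt0.
    rewrite lerXn2r ?nnegrE//; [by rewrite divr_ge0 ?ltW//; lra|by rewrite divr_ge0 ?ltW//; lra|].
    rewrite ler_pdivrMr; last by lra.
    rewrite mulrAC ler_pdivlMr; last by lra.
    by rewrite !mulrDr; nra.
  rewrite ler_nat; apply: subset_leq_card; apply/fintype.subsetP => e; rewrite !inE.
  apply: le_lt_trans; rewrite /s; lra.
(* Integrating [count] over [G] exchanges the count of flips for a sum of [2 ^+ n] equal
   probabilities. *)
have := @le_integral_comb R _ _ P1 unit {ffun 'I_n -> bool} (fun=> p * 2 ^+ n)
  (fun=> \1_G) (fun=> fine (P1 G))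
  (fun=> 1) (fun e => \1_[set t | s < S e t]) (fun e => fine (P1 [set t | s < S e t])).
rewrite !big_const/= card_unit/= addr0 => h.
have {h} : p * 2 ^+ n * fine (P1 G) <= \sum_e 1 * fine (P1 [set t | s < S e t]).
  apply: h => //.
  - by move=> _; rewrite mulr_ge0// exprn_ge0.
  - by move=> _; exact: integral_indicT.
  - by move=> e; exact: integral_indicT.
  - move=> t; rewrite big_const card_unit/= addr0 indicE.
    have [Gt|Gt] := pselect (G t); last first.
      by rewrite memNset// mulr0 sumr_ge0.
    rewrite mem_set// mulr1; apply: le_trans (count t Gt) _.
    rewrite -sum1_card natr_sum big_mkcond/=; apply: ler_sum => e _.
    rewrite mul1r indicE; case: ifPn => //; rewrite inE => st.
    by rewrite mem_set.
have P1E e : P1 [set t | s < S e t] = P1 (X @^-1` W) by rewrite WE flip_law.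
under eq_bigr do rewrite mul1r P1E.
rewrite sumr_const card_ffun card_bool card_ord -[leRHS]mulr_natr natrX.
rewrite mulrAC ler_pM2r ?exprn_gt0// => h.
have mXW : measurable (X @^-1` W) by exact: measurable_funPTI.
rewrite -(fineK (fin_num_measure P1 _ mXW)) lee_fin.
by apply: le_trans h; rewrite mulrC ler_wpM2l.
Qed.

End tail.

(** * Candidate facets *)

Section body.
Context (R : realType) (n : nat).

Definition in_body (k : R) (v : 'rV[R]_n) : Prop :=
  (forall j, `|v ord0 j| <= 1) /\ \sum_j v ord0 j ^+ 2 <= k.

Lemma in_bodyP (k : R) (v : 'rV[R]_n) : 0 < k ->
  (ball_linf n `&` dilate (Num.sqrt k) (ball_l2 n)) v <-> in_body k v.
Proof.
move=> k0; have sk : 0 < Num.sqrt k by rewrite sqrtr_gt0.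
have normE (u : 'rV[R]_n) : \sum_j `|u ord0 j| ^+ 2 = \sum_j u ord0 j ^+ 2.
  by apply: eq_bigr => j _; rewrite real_normK ?num_real.
split => -[v1 h]; split => //.
  case: h => u; rewrite /ball_l2/= normE => u1 <-.
  have -> : \sum_j (Num.sqrt k *: u) ord0 j ^+ 2 = k * \sum_j u ord0 j ^+ 2.
    by rewrite mulr_sumr; apply: eq_bigr => j _; rewrite mxE exprMn sqr_sqrtr ?ltW.
  rewrite ler_piMr ?(ltW k0)//; by move: u1; rewrite -[leRHS]sqrtr1 ler_sqrt.
exists ((Num.sqrt k)^-1 *: v); last by rewrite scalerA mulfV ?gt_eqF// scale1r.
rewrite /ball_l2/= normE -[leRHS]sqrtr1 ler_sqrt//.
have -> : \sum_j ((Num.sqrt k)^-1 *: v) ord0 j ^+ 2 = (\sum_j v ord0 j ^+ 2) / k.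
  rewrite mulr_suml; apply: eq_bigr => j _.
  by rewrite mxE exprMn exprVn sqr_sqrtr ?ltW// mulrC.
by rewrite ler_pdivrMr// mul1r.
Qed.

(** With [s] a sign, this makes the support function of the body dominate every coordinate of the
    direction. *)
Lemma in_body_delta (k : R) (s : R) (j : 'I_n) : 1 <= k -> `|s| <= 1 ->
  in_body k (s *: delta_mx ord0 j).
Proof.
move=> k1 s1; split=> [i|].
  by rewrite !mxE eqxx/=; case: (i == j); rewrite ?mulr1 ?mulr0 ?normr0.
rewrite (bigD1 j)//= big1 ?addr0 => [|i ij]; rewrite !mxE eqxx/=.
  rewrite eqxx mulr1 -real_normK ?num_real// (le_trans _ k1)//.
  by rewrite expr_le1.
by rewrite (negPf ij) mulr0 expr0n.
Qed.

Lemma bigmax_between (I : finType) (f : I -> R) (q : R) : 0 < q ->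
  (forall i, f i < q) -> exists D, [/\ 0 < D, D < q & forall i, f i <= D].
Proof.
move=> q0 fq; pose m := \big[Order.max/0]_i f i.
have mq : m < q by apply/bigmax_ltP; split.
have m0 : 0 <= m by exact: bigmax_ge_id.
exists ((m + q) / 2); split; [by lra|by lra|] => i.
by apply: (@le_trans _ _ m); [exact: le_bigmax|lra].
Qed.

End body.

Section candidates.
Context (R : realType) (n N : nat) (eta : R) (j0 : 'I_n).

(** The added multiples of the basis vectors make the points span, so that the polar has
    vertices. *)
Definition frame (Y : 'I_N -> 'rV[R]_n) (i : 'I_N + 'I_n) : 'rV[R]_n :=
  match i with inl i => Y i | inr j => eta *: delta_mx ord0 j end.

(** The default [inr j0] of [nth] is never reached when [#|J| = n]. *)
Definition facet_mx (J : {set 'I_N + 'I_n}) (Y : 'I_N -> 'rV[R]_n) : 'M[R]_n :=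
  \matrix_k frame Y (nth (inr j0) (enum J) k).

(* By Cramer's rule, [facet_normal / \det (facet_mx J Y)] solves the linear
   system saying that the rows indexed by [J] lie on the facet. *)
Definition facet_normal (J : {set 'I_N + 'I_n}) (s : {ffun 'I_n -> bool})
    (Y : 'I_N -> 'rV[R]_n) : 'rV[R]_n :=
  (\adj (facet_mx J Y) *m \col_k rad R (s k))^T.

(** This is why a candidate facet is independent of the points outside [J]. *)
Lemma eq_facet_mx (J : {set 'I_N + 'I_n}) (Y Y' : 'I_N -> 'rV[R]_n) : #|J| = n ->
  (forall i, inl i \in J -> Y i = Y' i) -> facet_mx J Y = facet_mx J Y'.
Proof.
move=> Jn YY; apply/row_matrixP => k; rewrite !rowK.
have : nth (inr j0) (enum J) k \in J.
  by rewrite -mem_enum mem_nth// -cardE Jn.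
by case: (nth _ _ _) => // i /YY.
Qed.

(** A separating direction is rescaled into the polar of the frame and pushed to a vertex, which
    Cramer's rule recovers from its tight points and their signs. *)
Lemma facet_exists (c k : R) (Y : 'I_N -> 'rV[R]_n) (v : 'rV[R]_n) :
  (0 < N)%N -> 0 < c -> eta = c / 2 -> 1 <= k -> in_body k v -> ~ absconv Y (c *: v) ->
  exists (J : {set 'I_N + 'I_n}) s v', [/\ #|J| = n, in_body k v', \det (facet_mx J Y) != 0 &
    let th := (\det (facet_mx J Y))^-1 *: facet_normal J s Y in
    1 < c * dot v' th /\ forall i, `|dot (Y i) th| <= 1].
Proof.
move=> N0 c0 etaE k1 bv /(absconv_separation N0)[u hu].
have cvu : 0 < c * dot v u.
  by rewrite -dotZl; apply: le_lt_trans (hu (Ordinal N0)); exact: normr_ge0.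
have vu : 0 < dot v u by rewrite pmulr_rgt0 in cvu.
(* If some coordinate of [u] exceeds [dot v u], a signed basis vector replaces [v]. The points
   [eta e_j] then stay below half of the level [c * dot v' u]. *)
have [v' [bv' vv' uv']] : exists v', [/\ in_body k v', dot v u <= dot v' u &
    forall j, `|u ord0 j| <= dot v' u].
  have [j _ jmax] := @Order.TotalTheory.arg_maxP _ _ _ j0 xpredT (fun j => `|u ord0 j|) isT.
  have [h|h] := leP `|u ord0 j| (dot v u).
    by exists v; split => // l; apply: le_trans h; exact: jmax.
  have e : dot (Num.sg (u ord0 j) *: delta_mx ord0 j) u = `|u ord0 j|.
    by rewrite dotZl dotC dot_delta -normrEsg.
  exists (Num.sg (u ord0 j) *: delta_mx ord0 j); rewrite e; split.
  - by apply: in_body_delta => //; rewrite normr_sg; case: (_ != _).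
  - exact: ltW.
  - by move=> l; exact: jmax.
have v'u : 0 < dot v' u by exact: lt_le_trans vv'.
have Zlt i : `|dot (frame Y i) u| < c * dot v' u.
  case: i => [i|j] /=.
    by apply: lt_le_trans (hu i) _; rewrite dotZl ler_pM2l.
  rewrite dotZl dotC dot_delta normrM etaE (ger0_norm (_ : 0 <= c / 2)); last first.
    by rewrite divr_ge0// ltW.
  apply: (@le_lt_trans _ _ (c / 2 * dot v' u)).
    by rewrite ler_wpM2l// divr_ge0// ltW.
  by rewrite ltr_pM2r//; lra.
(* Division by a level strictly between the frame and [c *: v'] makes [u] feasible with room to
   spare. *)
have [D [D0 Dq Dm]] := bigmax_between (mulr_gt0 c0 v'u) Zlt.
have [|||th' [th1 thv [J Jn [Jt Jk]]]] := @vertex_exists R n _ (frame Y) (c *: v') _ (D^-1 *: u).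
- move=> z hz; apply/rowP => j; have := hz (inr j).
  rewrite /= dotZl dotC dot_delta mxE => /eqP; rewrite mulf_eq0 etaE.
  by rewrite gt_eqF ?divr_gt0//= => /eqP.
- move=> i; rewrite dotZr normrM normfV (gtr0_norm D0) mulrC ler_pdivrMr//.
  by rewrite mul1r.
- by rewrite dotZr dotZl mulrC ltr_pdivlMr// mul1r.
pose s := [ffun k : 'I_n => dot (frame Y (nth (inr j0) (enum J) k)) th' == 1].
have sizeJ : size (enum J) = n by rewrite -cardE.
have nthJ (l : 'I_n) : nth (inr j0) (enum J) l \in J.
  by rewrite -mem_enum mem_nth// sizeJ.
have Amul (z : 'rV[R]_n) (l : 'I_n) : (facet_mx J Y *m z^T) l ord0 =
    dot (frame Y (nth (inr j0) (enum J) l)) z.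
  by rewrite mxE; apply: eq_bigr => j _; rewrite !mxE.
(* A kernel vector would be orthogonal to all tight points of the vertex, which span. *)
have d0 : \det (facet_mx J Y) != 0.
  rewrite -det_tr; apply/negP => /det0P[z z0 zA].
  move/eqP: z0; apply; apply: Jk => i iJ.
  have il : (index i (enum J) < n)%N by rewrite -[ltnRHS]sizeJ index_mem mem_enum.
  have := Amul z (Ordinal il); rewrite /= nth_index ?mem_enum// => <-.
  have -> : facet_mx J Y *m z^T = 0.
    by apply: trmx_inj; rewrite trmx_mul trmxK zA trmx0.
  by rewrite mxE.
have wE : facet_normal J s Y = \det (facet_mx J Y) *: th'.
  rewrite /facet_normal; have -> : \col_l rad R (s l) = facet_mx J Y *m th'^T.
    apply/matrixP => l m; rewrite ord1 Amul mxE /s ffunE /rad.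
    have := Jt _ (nthJ l); case: eqP => // ne.
    by move/eqP; rewrite eqr_norml ler01 andbT => /orP[/eqP|/eqP].
  by rewrite mulmxA mul_adj_mx mul_scalar_mx linearZ/= trmxK.
exists J, s, v'; split => //=.
rewrite wE scalerA mulVf// scale1r; split; first by rewrite -dotZl.
by move=> i; exact: (th1 (inl i)).
Qed.

End candidates.

(** * Union bound over the facets *)

(** The factor of [expR (- (k / 4))] in [tail_lower_bound]. *)
Definition tail_const (R : realType) (gamma delta : R) : R :=
  let kap := gamma ^+ 2 * delta ^+ 3 / 16 in delta / 4 * (kap / (16 + 4 * kap)) ^+ 2.

Section small_ball.
Context (R : realType) (d0 d1 : measure_display)
  (T0 : measurableType d0) (P0 : probability T0 R)
  (T1 : measurableType d1) (P1 : probability T1 R)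
  (n : nat) (x : {RV P0 >-> R}) (X : {RV P1 >-> n.-tuple R}) (gamma delta : R).
Hypothesis gamma0 : 0 < gamma.
Hypothesis delta0 : 0 < delta.
Hypothesis xsym : symmetric_rv P0 x.
Hypothesis xvar : ('E_P0[(fun t => (x t ^+ 2)%R)] = 1)%E.
Hypothesis xsmall : (delta%:E <= P0 [set t | (gamma <= `|x t|)%R])%E.
Hypothesis Xcop : independent_copies P0 P1 x (fun (j : 'I_n) t => tnth (X t) j).

Lemma measurable_dot_row (w : 'rV[R]_n) :
  measurable_fun setT (fun y : n.-tuple R => dot (row_of_tuple y) w).
Proof.
apply: measurable_sum => j; apply: measurable_funM => //.
under eq_fun do rewrite mxE.
exact: measurable_tnth.
Qed.

Lemma measurable_slab (w : 'rV[R]_n) (a : R) :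
  measurable [set y : n.-tuple R | `|dot (row_of_tuple y) w| <= a].
Proof.
rewrite -[X in measurable X]setTI; apply: measurable_fun_le => //.
by apply: measurableT_comp (measurable_dot_row w).
Qed.

(** The factor [gamma * delta / 8] is the one in the tail threshold: under the hypothesis this
    threshold exceeds 1, so the slab misses the tail event. *)
Lemma slab_probability (k : R) (v th : 'rV[R]_n) : 1 <= k -> in_body k v ->
  1 < gamma * delta / 8 * dot v th ->
  (P1 [set t | (`|dot (row_of_tuple (X t)) th| <= 1)%R] <=
   (1 - tail_const gamma delta * expR (- (k / 4)))%:E)%E.
Proof.
move=> k1 bv vth.
have gd0 : 0 < gamma * delta / 8 by rewrite divr_gt0// mulr_gt0.
have vth0 : 0 < dot v th.
  by rewrite -(pmulr_rgt0 _ gd0) (lt_trans _ vth).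
have th0 : th != 0.
  apply: contraTneq vth0 => ->; rewrite dotC /dot big1 ?ltxx// => j _.
  by rewrite mxE mul0r.
pose r := Num.sqrt (dot th th).
have r0 : 0 < r by rewrite sqrtr_gt0 dot_gt0.
have rr : r ^+ 2 = dot th th by rewrite sqr_sqrtr// dot_ge0.
(* Passing to a direction that also dominates the Euclidean norm. *)
have [u [bu uth ru]] : exists u, [/\ in_body k u, dot v th <= dot u th & r <= dot u th].
  have [h|h] := leP r (dot v th); first by exists v.
  have e : dot (r^-1 *: th) th = r by rewrite dotZl -rr expr2 mulKf// gt_eqF.
  exists (r^-1 *: th); rewrite e; split => //; last exact: ltW.
  have s1 : \sum_j (r^-1 *: th) ord0 j ^+ 2 = 1.
    by rewrite -dot_sqr dotZl dotZr -rr; field; rewrite gt_eqF.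
  split; last by rewrite s1.
  move=> j; rewrite -(@expr_le1 _ 2)// real_normK ?num_real// -s1.
  by rewrite (bigD1 j)//= lerDl sumr_ge0// => i _; rewrite sqr_ge0.
pose a := \sum_j `|u ord0 j| * `|th ord0 j|.
have ua : dot u th <= a.
  by apply: ler_sum => j _; rewrite -normrM ler_norm.
have a0 : 0 < a by rewrite (lt_le_trans _ ua)// (lt_le_trans r0).
have tha : \sum_j th ord0 j ^+ 2 <= a ^+ 2.
  by rewrite -dot_sqr -rr lerXn2r ?nnegrE ?(ltW r0) ?(ltW a0)//; exact: le_trans ua.
have := tail_lower_bound gamma0 delta0 xsym xvar xsmall Xcop bu.1 bu.2 a0 tha.
set W := [set t | _] => h.
have mW : measurable W.
  rewrite -[W]setTI; apply: measurable_fun_ltr => //.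
  apply: measurable_sum => j; apply: measurable_funM => //.
  exact: (measurableT_comp (measurable_tnth j)).
have mV : measurable [set t | `|dot (row_of_tuple (X t)) th| <= 1].
  by have := @measurable_funPTI _ _ _ _ X _ (measurable_slab th 1).
apply: (@le_trans _ _ (P1 (~` W))).
  apply: le_measure; rewrite ?inE//; first exact: measurableC.
  move=> t /= h1 h2; have : 1 < \sum_j th ord0 j * tnth (X t) j.
    apply: lt_trans h2; apply: (lt_le_trans vth); rewrite ler_pM2l//.
    exact: le_trans ua.
  rewrite ltNge => /negP; apply; apply: le_trans h1; apply: le_trans (ler_norm _).
  by rewrite /dot; apply: ler_sum => j _; rewrite mxE mulrC.
rewrite probability_setC// EFinB leeB//.
by apply: le_trans h; rewrite lee_fin /tail_const -[leLHS]mulrA.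
Qed.

End small_ball.

(** * Measurability of determinants and adjugates *)

Section facet_measurability.
Context (R : realType) (d : measure_display) (T : measurableType d).

Lemma measurable_det (m : nat) (A : T -> 'M[R]_m) :
  (forall i j, measurable_fun setT (fun t => A t i j)) ->
  measurable_fun setT (fun t => \det (A t)).
Proof.
move=> mA; rewrite /determinant; apply: measurable_sum => s.
by apply: measurable_funM => //; apply: measurable_prod => i _.
Qed.

Lemma measurable_adj (m : nat) (A : T -> 'M[R]_m) i j :
  (forall i j, measurable_fun setT (fun t => A t i j)) ->
  measurable_fun setT (fun t => (\adj (A t)) i j).
Proof.
move=> mA; under eq_fun do rewrite mxE.
rewrite /cofactor; apply: measurable_funM => //.
apply: measurable_det => k l; under eq_fun do rewrite !mxE; exact: mA.
Qed.

End facet_measurability.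

Lemma measure_bigsetU_le (R : realType) (d : measure_display) (T : measurableType d)
    (P : {measure set T -> \bar R}) (I : Type) (r : seq I) (F : I -> set T) :
  (forall i, measurable (F i)) ->
  (P (\big[setU/set0]_(i <- r) F i) <= \sum_(i <- r) P (F i))%E.
Proof.
move=> mF; elim: r => [|i r IH]; first by rewrite !big_nil measure0.
rewrite !big_cons; apply: le_trans (leeD2l _ IH).
by apply: measureU2 => //; exact: bigsetU_measurable.
Qed.

(** * Covering the failure event by facet events *)

Section covering.
Context (R : realType) (d1 d : measure_display)
  (T1 : measurableType d1) (P1 : probability T1 R)
  (T : measurableType d) (P : probability T R)
  (n N : nat) (X : {RV P1 >-> n.-tuple R}) (Xs : 'I_N -> {RV P >-> n.-tuple R}).
Hypothesis Xcop : independent_copies P1 P X (fun i => Xs i : T -> _).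
Variables (c k q : R).
Hypothesis n0 : (0 < n)%N.
Hypothesis N0 : (0 < N)%N.
Hypothesis c0 : 0 < c.
Hypothesis k1 : 1 <= k.
Hypothesis q0 : 0 <= q.
Hypothesis slab : forall v th : 'rV[R]_n, in_body k v -> 1 < c * dot v th ->
  (P1 [set t | (`|dot (row_of_tuple (X t)) th| <= 1)%R] <= q%:E)%E.

Let j0 : 'I_n := Ordinal n0.
Let eta := c / 2.
Let rows (y : N.-tuple (n.-tuple R)) (i : 'I_N) : 'rV[R]_n := row_of_tuple (tnth y i).
Let sample (t : T) (i : 'I_N) : 'rV[R]_n := row_of_tuple (Xs i t).
Let fail : set T := [set t | exists2 v, in_body k v & ~ absconv (sample t) (c *: v)].

Let mrows i j : measurable_fun setT (fun y => rows y i ord0 j).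
Proof.
under eq_fun do rewrite mxE.
exact: (measurableT_comp (measurable_tnth j) (measurable_tnth i)).
Qed.

Let mfacet J i j : measurable_fun setT (fun y => facet_mx eta j0 J (rows y) i j).
Proof.
under eq_fun do rewrite mxE; case: (nth _ _ _) => [l|l] /=; first exact: mrows.
exact: measurable_cst.
Qed.

Let mnormal J s j : measurable_fun setT (fun y => facet_normal eta j0 J s (rows y) ord0 j).
Proof.
under eq_fun do rewrite mxE mxE.
apply: measurable_sum => l; apply: measurable_funM.
  by apply: measurable_adj => i i'; exact: mfacet.
by under eq_fun do rewrite mxE; exact: measurable_cst.
Qed.

Section fixed_facet.
Variables (J : {set 'I_N + 'I_n}) (s : {ffun 'I_n -> bool}).
Hypothesis Jn : #|J| = n.

Let pt : n.-tuple R := [tuple 0 | i < n].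
(** [f] reveals the points indexed by [J] and [g] the remaining ones; [pt] fills the hidden
    places. *)
Let f (i : 'I_N) (y : n.-tuple R) := if inl i \in J then y else pt.
Let g (i : 'I_N) (y : n.-tuple R) := if inl i \in J then pt else y.
Let Yt t : N.-tuple (n.-tuple R) := [tuple f i (Xs i t) | i < N].
Let Zt t : N.-tuple (n.-tuple R) := [tuple g i (Xs i t) | i < N].
(** The slab condition for the points outside [J], multiplied through by the determinant so that
    degenerate facets cause no division. *)
Let E : set (N.-tuple (n.-tuple R) * N.-tuple (n.-tuple R)) :=
  [set yz | forall i, inl i \notin J ->
    `|dot (rows yz.2 i) (facet_normal eta j0 J s (rows yz.1))| <=
    `|\det (facet_mx eta j0 J (rows yz.1))|].

Let mE : measurable E.
Proof.
pose F i := [set yz : N.-tuple (n.-tuple R) * N.-tuple (n.-tuple R) |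
    `|dot (rows yz.2 i) (facet_normal eta j0 J s (rows yz.1))| <=
    `|\det (facet_mx eta j0 J (rows yz.1))|].
have -> : E = [set yz | forall i, (if inl i \notin J then F i else setT) yz].
  apply/seteqP; split => yz /= h i; have := h i.
    by case: ifP => // iJ; apply.
  by move=> /[swap] ->.
apply: measurable_forall => i; case: ifP => // _.
rewrite -[F i]setTI; apply: measurable_fun_le => //.
  apply: measurableT_comp => //; apply: measurable_sum => j; apply: measurable_funM.
    exact: (measurableT_comp (mrows i j) measurable_snd).
  exact: (measurableT_comp (mnormal J s j) measurable_fst).
apply: measurableT_comp => //; apply: measurable_det => i' j'.
exact: (measurableT_comp (mfacet J i' j') measurable_fst).
Qed.

Let q' := q ^+ (N - n).

(** Carrying the bound on the conditional probability inside the event makes its probability small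
    for every [J] and [s]; [facet_event_cover] checks that bound on the facets that occur. *)
Definition facet_event : set T :=
  [set t | E (Yt t, Zt t) /\ (P [set u | E (Yt t, Zt u)] <= q'%:E)%E].

Lemma facet_event_bound : measurable facet_event /\ (P facet_event <= q'%:E)%E.
Proof.
apply: (@independent_blocks_section R _ _ _ _ _ _ P N (fun i => Xs i) f g) => //.
- by move=> i; rewrite /f; case: (inl i \in J); [exact: measurable_id|exact: measurable_cst].
- by move=> i; rewrite /g; case: (inl i \in J); [exact: measurable_cst|exact: measurable_id].
- exact: Xcop.1.
- by move=> i; rewrite /f /g; case: (inl i \in J); [right|left]; exists pt.
- by rewrite exprn_ge0.
Qed.

(** Once the points of [J] are frozen, [th] is deterministic, and the other samples fall in its slab
    independently, each with probability at most [q]. *)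
Lemma facet_event_cover t v :
  in_body k v -> \det (facet_mx eta j0 J (sample t)) != 0 ->
  let th := (\det (facet_mx eta j0 J (sample t)))^-1 *:
            facet_normal eta j0 J s (sample t) in
  1 < c * dot v th -> (forall i, `|dot (sample t i) th| <= 1) -> q <= 1 ->
  facet_event t.
Proof.
move=> bv D0 th vth thle q1.
have YE : facet_mx eta j0 J (rows (Yt t)) = facet_mx eta j0 J (sample t).
  apply: eq_facet_mx => // i iJ.
  by rewrite /rows /sample tnth_mktuple /f iJ.
set D := \det (facet_mx eta j0 J (sample t)) in D0 th vth thle.
have wE : facet_normal eta j0 J s (rows (Yt t)) = D *: th.
  by rewrite /facet_normal YE /th scalerA mulfV// scale1r.
have ZE u i : inl i \notin J -> rows (Zt u) i = sample u i.
  by move=> iJ; rewrite /rows /sample tnth_mktuple /g (negPf iJ).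
have leE (z : 'rV[R]_n) : (`|dot z (D *: th)| <= `|D|) = (`|dot z th| <= 1).
  by rewrite dotZr normrM -{2}[`|D|]mulr1 ler_pM2l// normr_gt0.
have EE u : E (Yt t, Zt u) <-> forall i, inl i \notin J -> `|dot (sample u i) th| <= 1.
  rewrite /E/= YE wE; split => h i iJ; have := h i iJ; by rewrite ZE// leE.
split; first by apply/EE => i _; exact: thle.
pose A i : set (n.-tuple R) := if inl i \notin J
  then [set y | `|dot (row_of_tuple y) th| <= 1] else setT.
have mA i : measurable (A i) by rewrite /A; case: ifP => // _; exact: measurable_slab.
have -> : [set u | E (Yt t, Zt u)] = [set u | forall i, A i (Xs i u)].
  apply/seteqP; split => u /=.
    by move=> /EE h i; rewrite /A; case: ifP => // /h.
  by move=> h; apply/EE => i iJ; have := h i; rewrite /A iJ.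
rewrite (Xcop.1 _ mA).
have PA i : (P (Xs i @^-1` A i) <= (if inl i \notin J then q else 1)%:E)%E.
  rewrite /A; case: ifP => iJ; last by rewrite preimage_setT probability_setT.
  have := Xcop.2 i _ (measurable_slab th 1); rewrite /pushforward => /= <-.
  exact: slab bv vth.
apply: (@le_trans _ _ (\prod_i (if inl i \notin J then q else 1)%:E)%E).
  suff /andP[] : (0 <= \prod_i P (Xs i @^-1` A i) <=
      \prod_i (if inl i \notin J then q else 1)%:E)%E by [].
  apply: (big_ind2 (fun a b => (0 <= a) && (a <= b))%E) => //.
  - by rewrite lee01 lexx.
  - move=> a b a' b' /andP[a0 ab] /andP[a'0 ab'].
    by rewrite mule_ge0//= lee_pmul.
  - by move=> i _; rewrite measure_ge0 PA.
rewrite prodEFin lee_fin -big_mkcond/= prodr_const.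
(* As [q <= 1], it is enough that at least [N - n] samples lie outside [J], which has only [n]
   elements. *)
rewrite ler_wiXn2l//.
rewrite leq_subLR -[X in (X <= _)%N](card_ord N).
rewrite -(cardC [pred i : 'I_N | inl i \in J]) leq_add//.
have inl_inj : injective (@inl 'I_N 'I_n) by move=> i i' [].
rewrite -[leqRHS]Jn -(fintype.card_image inl_inj).
by apply: subset_leq_card; apply/fintype.subsetP => _ /fintype.imageP[i iJ ->].
Qed.

End fixed_facet.

(** Strict separation survives rational approximation of the normal and the level, so [fail] is a
    countable union of measurable events. *)
Let mfail : measurable fail.
Proof.
pose real_of (th : 'rV[rat]_n) : 'rV[R]_n := map_mx ratr th.
pose level (p : 'rV[rat]_n * rat) : Prop :=
  exists2 v, in_body k v & ratr p.2 < c * dot v (real_of p.1).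
pose below (p : 'rV[rat]_n * rat) : set T :=
  [set t | forall i, `|dot (sample t i) (real_of p.1)| <= ratr p.2].
have -> : fail = \bigcup_p (if `[< level p >] then below p else set0).
  apply/seteqP; split => t /=; last first.
    move=> [[th r] _] /=; case: asboolP => // -[v bv lt] h; exists v => //.
    apply: (@absconv_support _ _ _ _ (real_of th)) => i.
    by rewrite dotZl; apply: le_lt_trans (h i) lt.
  move=> [v bv /(absconv_separation N0)[u hu]].
  have cvu : 0 < dot (c *: v) u.
    by apply: le_lt_trans (hu (Ordinal N0)); exact: normr_ge0.
  have [D [D0 Dlt hD]] := bigmax_between cvu hu.
  (* A quarter of the gap: approximating the normal costs [e] on either side, and the remaining
     interval contains a rational level. *)
  pose e := (dot (c *: v) u - D) / 4.
  have e0 : 0 < e by rewrite divr_gt0// subr_gt0.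
  (* Dominates the l1 norms of all samples and of [c *: v], so coordinate errors [e / B] move each
     dot product by at most [e]. *)
  pose B := 1 + \sum_i \sum_j `|sample t i ord0 j| + \sum_j `|(c *: v) ord0 j|.
  have S0 : 0 <= \sum_i \sum_j `|sample t i ord0 j|.
    by apply: sumr_ge0 => i _; apply: sumr_ge0.
  have S1 : 0 <= \sum_j `|(c *: v) ord0 j| by apply: sumr_ge0.
  have B0 : 0 < B by rewrite /B; lra.
  have eB : 0 < e / B by rewrite divr_gt0.
  have approx j : exists r : rat, `|ratr r - u ord0 j| <= e / B.
    have [|r] := @rat_in_itvoo R (u ord0 j - e / B) (u ord0 j + e / B); first by lra.
    rewrite in_itv/= => /andP[l1 l2]; exists r; rewrite ler_norml; apply/andP; split; lra.
  have [r hr] := choice approx.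
  pose th : 'rV[rat]_n := \row_j r j.
  have close (z : 'rV[R]_n) : \sum_j `|z ord0 j| <= B ->
      `|dot z (real_of th) - dot z u| <= e.
    move=> zB; rewrite -dotBr; apply: le_trans (ler_norm_sum _ _ _) _.
    apply: (@le_trans _ _ (\sum_j `|z ord0 j| * (e / B))).
      apply: ler_sum => j _; rewrite normrM ler_wpM2l// !mxE; exact: hr.
    rewrite -mulr_suml; apply: (@le_trans _ _ (B * (e / B))).
      by rewrite ler_wpM2r// ltW.
    by rewrite mulrCA mulfV ?mulr1// gt_eqF.
  have [|p] := @rat_in_itvoo R (D + e) (dot (c *: v) u - e); first by rewrite /e; lra.
  rewrite in_itv/= => /andP[p1 p2].
  exists (th, p) => //=; case: asboolP => [_ i|[]] /=.
    have : `|dot (sample t i) (real_of th) - dot (sample t i) u| <= e.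
      apply: close; rewrite /B (bigD1 i)//=.
      have : 0 <= \sum_(i' | i' != i) \sum_j `|sample t i' ord0 j|.
        by apply: sumr_ge0 => i' _; apply: sumr_ge0.
      by lra.
    have := hD i; rewrite !ler_norml => /andP[h1 h2] /andP[h3 h4].
    by apply/andP; split; lra.
  exists v => //; rewrite -dotZl /=.
  have : `|dot (c *: v) (real_of th) - dot (c *: v) u| <= e by apply: close; rewrite /B; lra.
  by rewrite ler_norml => /andP[h1 h2]; lra.
apply: countable_bigcupT_measurable => [|p]; first exact: countableP.
case: asboolP => // _; apply: measurable_forall => i.
by have := @measurable_funPTI _ _ _ _ (Xs i) _ (measurable_slab (real_of p.1) (ratr p.2)).
Qed.

Lemma fail_bound : q <= 1 -> measurable fail /\
  (P fail <= ('C(N + n, n)%:R * 2 ^+ n * q ^+ (N - n))%:E)%E.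
Proof.
move=> q1; split; first exact: mfail.
pose I := ({set 'I_N + 'I_n} * {ffun 'I_n -> bool})%type.
(* Index sets of the wrong size get the empty event, so the union runs over a finite type. *)
pose F (p : I) : set T := if #|p.1| == n then facet_event p.1 p.2 else set0.
have mF p : measurable (F p).
  rewrite /F; case: eqP => // Jn; exact: (facet_event_bound p.1 p.2).1.
have PF p : (P (F p) <= (if #|p.1| == n then q ^+ (N - n) else 0)%:E)%E.
  by rewrite /F; case: eqP => [Jn|_]; [exact: (facet_event_bound p.1 p.2).2|rewrite measure0].
apply: (@le_trans _ _ (\sum_(p : I) P (F p))%E).
  have : fail `<=` \big[setU/set0]_(p : I) F p.
    move=> t [v bv hv].
    have [J [s [v' [Jn bv' D0 [vth thle]]]]] :=
      facet_exists j0 N0 c0 (erefl (c / 2)) k1 bv hv.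
    rewrite -bigcup_seq; exists (J, s); first by rewrite /= mem_index_enum.
    by rewrite /F /= Jn eqxx; apply: (facet_event_cover Jn bv' D0 vth thle q1).
  move=> sub; apply: (@le_trans _ _ (P (\big[setU/set0]_(p : I) F p))).
    by apply: le_measure; rewrite ?inE//; exact: bigsetU_measurable.
  exact: measure_bigsetU_le.
apply: (@le_trans _ _ (\sum_(p : I) (if #|p.1| == n then q ^+ (N - n) else 0)%:E)%E).
  by apply: lee_sum => p _.
rewrite sumEFin lee_fin -big_mkcond/= sumr_const -[leLHS]mulr_natl.
rewrite ler_wpM2r ?exprn_ge0// -natrX -natrM ler_nat.
have -> : #|[pred p : I | #|p.1| == n]| =
    (#|[set J : {set 'I_N + 'I_n} | #|J| == n]%SET| * #|{: {ffun 'I_n -> bool}}|)%N.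
  rewrite -cardsT -cardsX; apply: eq_card => -[J s].
  by rewrite !inE andbT.
by rewrite card_draws card_sum !card_ord card_ffun card_bool card_ord.
Qed.

End covering.

(** * Numerical estimates *)

(** With [x = n / m], one term of the expansion of [(1 + x) ^+ m] is kept, and the whole is at most
    [expR (m * x) = expR n]. *)
Lemma binomial_le_expR (R : realType) (m n : nat) : (0 < n)%N -> (n <= m)%N ->
  'C(m, n)%:R <= (expR 1 * (m%:R / n%:R)) ^+ n :> R.
Proof.
move=> n0 nm; have m0 : (0 < m)%N by exact: leq_trans nm.
have n0' : 0 < n%:R :> R by rewrite ltr0n.
have m0' : 0 < m%:R :> R by rewrite ltr0n.
pose x : R := n%:R / m%:R.
have x0 : 0 < x by rewrite divr_gt0.
have le1 : x ^+ n * 'C(m, n)%:R <= (1 + x) ^+ m.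
  rewrite exprDn (bigD1 (inord n))//= inordK//.
  rewrite expr1n mul1r mulr_natr lerDl; apply: sumr_ge0 => i _.
  by rewrite expr1n mul1r mulrn_wge0// exprn_ge0// ltW.
have le2 : (1 + x) ^+ m <= expR 1 ^+ n.
  rewrite -!expRM_natl mulr1 (_ : n%:R = m%:R * x); last first.
    by rewrite /x mulrCA mulfV ?mulr1// gt_eqF.
  rewrite expRM_natl lerXn2r ?nnegrE ?expR_ge0 ?addr_ge0 ?(ltW x0)//.
  exact: expR_ge1Dx.
have -> : (expR 1 * (m%:R / n%:R)) ^+ n = expR 1 ^+ n / x ^+ n :> R.
  by rewrite -expr_div_n; congr (_ ^+ _); rewrite /x invf_div.
by rewrite ler_pdivlMr ?exprn_gt0// mulrC; exact: le_trans le2.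
Qed.

(** In terms of the ratio [r = N / n] the bound is an [n]-th power, so the claim reduces to the
    inequality [main] in [r] alone. *)
Lemma union_bound_small (R : realType) (alpha kp : R) :
  0 < alpha -> alpha < 1 -> 0 < kp ->
  exists c0 : R, 0 < c0 /\ forall n N : nat, (0 < n)%N -> c0 * n%:R <= N%:R ->
    let k := alpha * ln (expR 1 * N%:R / n%:R) in
    let q := 1 - kp * expR (- (k / 4)) in
    [/\ (n <= N)%N, 1 <= k & 0 <= q ->
     'C(N + n, n)%:R * 2 ^+ n * q ^+ (N - n) <=
     2 * expR (- (1 * (N%:R `^ (1 - alpha) * n%:R `^ alpha)))].
Proof.
move=> a0 a1 kp0; pose s := 1 - alpha; have s0 : 0 < s by rewrite subr_gt0.
(* Chosen so that [kp * (3 / 8) * M = 5 + s^-1]. *)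
pose M := (5 + s^-1) * 8 / (3 * kp).
have M0 : 0 < M by rewrite divr_gt0 ?mulr_gt0// addr_gt0// invr_gt0.
(* The three terms serve, in order, [r - 1 >= r / 2], [k >= 1] and
   [M <= r powered to 3 * alpha / 4]. *)
exists (2 + expR alpha^-1 + M `^ (4 / (3 * alpha))); split.
  by rewrite addr_gt0 ?powR_gt0// addr_gt0// expR_gt0.
move=> n N n0 cN k q.
have n0' : 0 < n%:R :> R by rewrite ltr0n.
pose r : R := N%:R / n%:R.
have cr : 2 + expR alpha^-1 + M `^ (4 / (3 * alpha)) <= r by rewrite ler_pdivlMr.
have e0 : 0 < expR alpha^-1 by exact: expR_gt0.
have Mp0 : 0 < M `^ (4 / (3 * alpha)) by exact: powR_gt0.
have r2 : 2 <= r by lra.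
have re : expR alpha^-1 <= r by lra.
have rM : M `^ (4 / (3 * alpha)) <= r by lra.
have r0 : 0 < r by lra.
have NE : N%:R = n%:R * r :> R by rewrite /r mulrCA mulfV ?mulr1// gt_eqF.
have nN : (n <= N)%N by rewrite -(ler_nat R) NE; nra.
have kE : k = alpha * (1 + ln r).
  by rewrite /k -mulrA lnM ?posrE ?expR_gt0// expRK.
have lnr : alpha^-1 <= ln r by rewrite -[leLHS]expRK ler_ln ?posrE.
have k1 : 1 <= k.
  have : 1 <= alpha * ln r by rewrite -(mulfV (lt0r_neq0 a0)) ler_pM2l.
  by rewrite kE; lra.
split => // q0.
have rs0 : 0 < r `^ s by exact: powR_gt0.
have rs1 : 1 <= r `^ s.
  by rewrite -(powRr0 r) ler_powR//; lra.
have lns : ln r <= s^-1 * r `^ s.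
  rewrite -(ler_pM2l s0) mulrA mulfV ?gt_eqF// mul1r -ln_powR.
  exact: (le_trans (ltW (ln_sublinear rs0))).
have rM' : M <= r `^ (3 * alpha / 4).
  have -> : M = (M `^ (4 / (3 * alpha))) `^ (3 * alpha / 4).
    rewrite -powRrM (_ : _ * _ = 1) ?powRr1 ?ltW//.
    by field; rewrite gt_eqF.
  by rewrite ge0_ler_powR ?nnegrE ?(ltW r0) ?(ltW Mp0)// divr_ge0// mulr_ge0// ltW.
(* The factor [3 / 4] bounds [expR (- (alpha / 4))] from below, as [alpha < 1]. *)
have pr : 3 / 4 * r `^ (- (alpha / 4)) <= expR (- (k / 4)).
  have -> : expR (- (k / 4)) = expR (- (alpha / 4)) * r `^ (- (alpha / 4)).
    rewrite /powR gt_eqF// -expRD; congr expR; by rewrite kE; field.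
  rewrite ler_wpM2r ?powR_ge0//; apply: le_trans (expR_ge1Dx _); lra.
(* The right side grows like [r] to the power [1 - alpha / 4], which beats the power [s = 1 - alpha]
   on the left by [3 * alpha / 4]. *)
have main : 4 + ln r + r `^ s <= kp * expR (- (k / 4)) * (r - 1).
  apply: (@le_trans _ _ ((5 + s^-1) * r `^ s)).
    by rewrite mulrDl; lra.
  apply: (@le_trans _ _ (kp * (3 / 8) * (r `^ (3 * alpha / 4) * r `^ s))).
    rewrite mulrA ler_wpM2r ?(ltW rs0)//.
    apply: (@le_trans _ _ (kp * (3 / 8) * M)); last first.
      by rewrite ler_wpM2l// mulr_ge0 ?(ltW kp0).
    by rewrite /M le_eqVlt; apply/orP; left; apply/eqP; field; rewrite gt_eqF//= gt_eqF.
  have -> : r `^ (3 * alpha / 4) * r `^ s = r `^ (- (alpha / 4)) * r.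
    rewrite -[X in _ = _ * X](powRr1 (ltW r0)) -!powRD; last 2 first.
    - by rewrite (gt_eqF r0) implybT.
    - by rewrite (gt_eqF r0) implybT.
    by congr (_ `^ _); rewrite /s; field.
  rewrite -[leLHS]mulrA -[leRHS]mulrA ler_wpM2l ?(ltW kp0)//.
  apply: (@le_trans _ _ (3 / 4 * r `^ (- (alpha / 4)) * (r - 1))).
    have : 0 <= r `^ (- (alpha / 4)) by exact: powR_ge0.
    by nra.
  by apply: ler_wpM2r; [lra|exact: pr].
have qe : q <= expR (- (kp * expR (- (k / 4)))) by exact: expR_ge1Dx.
have NnE : (N - n)%:R = n%:R * (r - 1) :> R by rewrite natrB// NE; ring.
pose Y : R := expR 1 * (1 + r) * 2 * expR (- (kp * expR (- (k / 4)) * (r - 1))).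
have YE : (expR 1 * ((N + n)%:R / n%:R)) ^+ n * 2 ^+ n *
    expR (- (kp * expR (- (k / 4)))) ^+ (N - n) = Y ^+ n.
  have -> : (N + n)%:R / n%:R = 1 + r :> R.
    by rewrite natrD NE; field; rewrite gt_eqF.
  rewrite /Y !exprMn; congr (_ * _).
  by rewrite -!expRM_natl NnE; congr expR; ring.
apply: (@le_trans _ _ (Y ^+ n)).
  rewrite -YE; apply: ler_pM.
  - by rewrite mulr_ge0// exprn_ge0.
  - by rewrite exprn_ge0.
  - rewrite ler_wpM2r ?exprn_ge0//; apply: binomial_le_expR => //.
    exact: leq_addl.
  - by rewrite lerXn2r ?nnegrE ?expR_ge0.
(* The prefactor [2 * expR 1 * (1 + r)] is absorbed into [expR 4 * r], the source of [4 + ln r] in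
   [main]. *)
have YY : Y <= expR (- r `^ s).
  apply: (@le_trans _ _ (expR (4 + ln r) * expR (- (kp * expR (- (k / 4)) * (r - 1))))).
    rewrite ler_wpM2r ?expR_ge0// expRD lnK ?posrE//.
    have -> : expR 4 = expR 1 * expR 3 :> R by rewrite -expRD; congr expR; lra.
    have : 4 <= expR 3 :> R by apply: le_trans (expR_ge1Dx _); lra.
    have : 0 < expR 1 :> R by exact: expR_gt0.
    move: (expR 1) (expR 3) => e1 e3 h1 h3.
    rewrite -!mulrA ler_pM2l//; nra.
  by rewrite -expRD ler_expR; lra.
have Y0 : 0 <= Y by rewrite !mulr_ge0 ?expR_ge0//; lra.
apply: (@le_trans _ _ (expR (- r `^ s) ^+ n)).
  by rewrite lerXn2r ?nnegrE ?expR_ge0.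
rewrite -expRM_natl mul1r.
have -> : N%:R `^ s * n%:R `^ alpha = n%:R * r `^ s :> R.
  rewrite NE powRM ?ltW// mulrAC -powRD; last by rewrite (gt_eqF n0') implybT.
  by rewrite /s subrK powRr1 ?ltW.
rewrite mulrN; have := expR_gt0 (- (n%:R * r `^ s)); lra.
Qed.

(** * Range of the tail constant and assembly of the bounds *)

Lemma tail_const_gt0 (R : realType) (gamma delta : R) :
  0 < gamma -> 0 < delta -> 0 < tail_const gamma delta.
Proof.
move=> g0 d0; rewrite /tail_const.
have kap0 : 0 < gamma ^+ 2 * delta ^+ 3 / 16 by rewrite divr_gt0// mulr_gt0// exprn_gt0.
by rewrite mulr_gt0 ?divr_gt0// exprn_gt0// divr_gt0//; lra.
Qed.

Lemma tail_const_le1 (R : realType) (gamma delta : R) :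
  0 < gamma -> 0 < delta -> delta <= 1 -> tail_const gamma delta <= 1.
Proof.
move=> g0 d0 d1; rewrite /tail_const.
set kap := gamma ^+ 2 * _ / 16.
have kap0 : 0 < kap by rewrite divr_gt0// mulr_gt0// exprn_gt0.
have h : (kap / (16 + 4 * kap)) ^+ 2 <= 1.
  rewrite expr_le1//; first by rewrite ler_pdivrMr; lra.
  by rewrite divr_ge0; lra.
have h0 : 0 <= (kap / (16 + 4 * kap)) ^+ 2 by exact: sqr_ge0.
by apply: mulr_ile1 => //; lra.
Qed.

Theorem theorem3p7 (R : realType) :
  exists c1 : R, 0 < c1 /\
  forall gamma delta : R, 0 < gamma -> 0 < delta ->
  exists c2 : R, 0 < c2 /\
  forall alpha : R, 0 < alpha -> alpha < 1 ->
  exists c0 : R, 0 < c0 /\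
  forall (d0 d1 d : measure_display)
    (T0 : measurableType d0) (P0 : probability T0 R)
    (T1 : measurableType d1) (P1 : probability T1 R)
    (T : measurableType d) (P : probability T R)
    (n N : nat)
    (x : {RV P0 >-> R})
    (X : {RV P1 >-> n.-tuple R})
    (Xs : 'I_N -> {RV P >-> n.-tuple R}),
  symmetric_rv P0 x ->
  ('E_P0[(fun t => (x t ^+ 2)%R)] = 1)%E ->
  (delta%:E <= P0 [set t | (gamma <= `|x t|)%R])%E ->
  independent_copies P0 P1 x (fun (j : 'I_n) t => tnth (X t) j) ->
  independent_copies P1 P X (fun i => Xs i : T -> _) ->
  (0 < n)%N ->
  c0 * n%:R <= N%:R ->
  ((1 - 2 * expR (- (c1 * (N%:R `^ (1 - alpha) * n%:R `^ alpha))))%:E <=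
   P [set t |
       dilate c2 (ball_linf n `&`
         dilate (Num.sqrt (alpha * ln (expR 1 * N%:R / n%:R))) (ball_l2 n))
       `<=` absconv (fun i => row_of_tuple (Xs i t))])%E.
Proof.
exists 1; split; first exact: ltr01.
move=> gamma delta gamma0 delta0.
have c20 : 0 < gamma * delta / 8 by rewrite divr_gt0// mulr_gt0.
exists (gamma * delta / 8); split => // alpha alpha0 alpha1.
have [c0 [c00 numeric]] :=
  union_bound_small alpha0 alpha1 (tail_const_gt0 gamma0 delta0).
exists c0; split => // d0 d1 d T0 P0 T1 P1 T P n N x X Xs xsym xvar xsmall.
move=> Xcop Xscop n0 cN.
have [nN k1] := numeric n N n0 cN.
set k := alpha * ln _ in k1 *; set q := 1 - _ => final.
(* As a lower bound for a probability, [delta] is at most 1; this keeps [q] nonnegative. *)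
have delta1 : delta <= 1.
  rewrite -lee_fin; apply: le_trans xsmall _; apply: probability_le1.
  have mA : measurable [set y : R | gamma <= `|y|].
    rewrite -[X in measurable X]setTI.
    exact: (@measurable_fun_le _ _ _ setT (fun=> gamma) (fun y : R => `|y|)).
  by have := @measurable_funPTI _ _ _ _ x _ mA.
have tc0 := tail_const_gt0 gamma0 delta0.
have tc1 := tail_const_le1 gamma0 delta0 delta1.
have e0 : 0 <= expR (- (k / 4)) by exact: expR_ge0.
have e1 : expR (- (k / 4)) <= 1.
  by rewrite -[leRHS]expR0 ler_expR oppr_le0 divr_ge0// (le_trans _ k1).
have q0 : 0 <= q by rewrite subr_ge0 mulr_ile1// ltW.
have q1 : q <= 1 by rewrite /q lerBlDr lerDl mulr_ge0// ltW.
have slab v th : in_body k v -> 1 < gamma * delta / 8 * dot v th ->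
    (P1 [set t | (`|dot (row_of_tuple (X t)) th| <= 1)%R] <= q%:E)%E.
  exact: (slab_probability gamma0 delta0 xsym xvar xsmall Xcop k1).
have [mfail Pfail] :=
  fail_bound Xscop n0 (leq_trans n0 nN) c20 k1 q0 slab q1.
set fail := [set t | _] in mfail Pfail.
(* The inclusion fails exactly when some point of the scaled body is outside the hull. *)
have -> : [set t | dilate (gamma * delta / 8)
    (ball_linf n `&` dilate (Num.sqrt k) (ball_l2 n))
    `<=` absconv (fun i => row_of_tuple (Xs i t))] = ~` fail.
  have k0 : 0 < k by lra.
  apply/seteqP; split => t /=.
    by move=> h [v /(in_bodyP _ k0) bv]; apply; apply: h; exists v.
  move=> h _ [v /(in_bodyP _ k0) bv <-].
  by apply: contrapT => hv; apply: h; exists v.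
rewrite probability_setC// EFinB leeB//.
by apply: le_trans Pfail _; rewrite lee_fin; exact: final.
Qed.
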